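(* Let $n\ge 2$ be an integer. Put $S_n=\sum_{l=1}^{n-1}\csc\frac{\pi l}{n}$ and, for $\nu\in\{1,\ldots,n-1\}$, $C_n(\nu)=\sum_{l=1}^{n-1}\cos\frac{2\pi\nu l}{n}\csc\frac{\pi l}{n}$. Then $$\sum_{\nu=1}^{n-1}\Psi\!\left(\frac{\nu}{n}\right)\csc\frac{\pi\nu}{n}=-(\gamma+\ln 2\pi n)\,S_n-2\sum_{\nu=1}^{n-1}C_n(\nu)\,\ln\Gamma\!\left(\frac{\nu}{n}\right).$$
   Context: $\Gamma$ is the gamma function, $\Psi=\Gamma'/\Gamma$ is the digamma function and $\gamma$ is Euler's constant; $\ln 2\pi n$ means $\ln(2\pi n)$. *)

(* Defs.v *)
From HB Require Import structures.
From mathcomp Require Import all_boot all_order all_algebra.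
From mathcomp Require Import all_classical all_reals all_analysis.

Set Implicit Arguments.
Unset Strict Implicit.
Unset Printing Implicit Defensive.

Import Order.TTheory GRing.Theory Num.Theory.
Import numFieldNormedType.Exports.

Local Open Scope classical_set_scope.
Local Open Scope ring_scope.

(* Euler's integral: this is the gamma function only for 0 < x; elsewhere the
   integral diverges and the value is meaningless. *)
Definition Gamma (R : realType) (x : R) : R :=
  \int[@lebesgue_measure R]_(t in `]0, +oo[) (t `^ (x - 1) * expR (- t)).

(* Meaningful for 0 < x, like Gamma. *)
Definition digamma (R : realType) (x : R) : R := derive1 (@Gamma R) x / Gamma x.

(* [series harmonic m] is 1 + 1/2 + ... + 1/m. *)
Definition euler_gamma (R : realType) : R :=
  limn (fun m : nat => series (@harmonic R) m - ln (m%:R : R)).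

Definition csc (R : realType) (x : R) : R := (sin x)^-1.

Definition csc_sum (R : realType) (n : nat) : R :=
  \sum_(1 <= l < n) csc (pi * l%:R / n%:R).

Definition cos_csc_sum (R : realType) (n nu : nat) : R :=
  \sum_(1 <= l < n) cos (2 * pi * nu%:R * l%:R / n%:R) * csc (pi * l%:R / n%:R).

(* Main.v *)
Require Import Defs.
From HB Require Import structures.
From mathcomp Require Import all_boot all_order all_algebra.
From mathcomp Require Import all_classical all_reals all_analysis.
From mathcomp Require Import measurable_realfun ring lra.

Set Implicit Arguments.
Unset Strict Implicit.
Unset Printing Implicit Defensive.

Import Order.TTheory GRing.Theory Num.Theory.
Import numFieldNormedType.Exports.

Local Open Scope classical_set_scope.
Local Open Scope ring_scope.

(** Both sides are invariant under [nu -> n - nu].  Averaging over this symmetry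
    turns [Gamma] into [Gamma x * Gamma (1 - x) = pi / sin (pi x)] on the right
    and leaves [digamma x + digamma (1 - x)] on the left, so that with
    [\sum_nu cos (2 pi nu l / n) = -1] the claim becomes Gauss's formula
    [digamma (l/n) + digamma (1 - l/n) =
     - 2 gamma - 2 ln (2 n) + 2 \sum_nu cos (2 pi nu l / n) ln (sin (pi nu / n))].

    Euler's limit for [Gamma] comes from the functional equation and the tangent
    line inequality [t ^ x <= (1 - x) m ^ x + x m ^ (x - 1) t] integrated against
    [t ^ (m - 1) e ^ (- t)]; a second order Taylor bound uniform in the
    approximation index transfers it to [digamma].  The sine product comes from
    the integrals of [cos (2 x t) cos t ^ (2 K)] over [[0, pi / 2]].  Gauss's
    formula is a finite Fourier inversion of the series
    [\sum_k cos (k t) / k = - ln (2 sin (t / 2))]. *)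

(** * The gamma integral *)

Section FTC.
Variable R : realType.
Notation mu := (@lebesgue_measure R).
Implicit Types (f F : R -> R) (a b : R).

Lemma is_derive_continuous f (x d : R) : is_derive x 1 f d -> {for x, continuous f}.
Proof. by move=> H; apply/differentiable_continuous/derivable1_diffP. Qed.

Lemma FTC2_is_derive f F a b : a < b ->
  {in `[a, b], forall x : R, is_derive x 1 F (f x)} ->
  {in `[a, b], forall x : R, {for x, continuous f}} ->
  (\int[mu]_(x in `[a, b]) (f x)%:E = (F b - F a)%:E)%E.
Proof.
move=> ab dF cf; rewrite EFinB; apply: continuous_FTC2 => //.
- by apply: continuous_in_subspaceT => x; rewrite inE; exact: cf.
- split.
  + by move=> x /subset_itv_oo_cc /dF [].
  + apply: cvg_at_right_filter; apply: (@is_derive_continuous _ _ (f a)).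
    by apply: dF; rewrite in_itv/= lexx ltW.
  + apply: cvg_at_left_filter; apply: (@is_derive_continuous _ _ (f b)).
    by apply: dF; rewrite in_itv/= lexx ltW.
- by move=> x /subset_itv_oo_cc /dF H; rewrite derive1E; apply: derive_val.
Qed.

Lemma bigcup_itv_inv_succ :
  \bigcup_(i : nat) `[(i.+1%:R : R)^-1, i.+1%:R]%classic = `]0, +oo[%classic.
Proof.
apply/seteqP; split => x /=.
  move=> [i _] /=; rewrite !in_itv/= andbT => /andP[+ _].
  by apply: lt_le_trans; rewrite invr_gt0 ltr0n.
rewrite in_itv/= andbT => x0.
pose k := Num.truncn (Num.max x x^-1); exists k => //=.
have : Num.max x x^-1 <= k.+1%:R by apply/ltW/truncnS_gt.
rewrite ge_max in_itv/= => /andP[-> h]; rewrite andbT.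
by rewrite invf_ple ?posrE ?ltr0n.
Qed.

(** Monotone convergence along compact segments, on which the fundamental theorem of calculus
    applies. Both ends move, since the gamma integrand may be singular at 0. *)
Lemma cvg_integral_0y (g : R -> R) : measurable_fun setT g ->
  {in `]0, +oo[, forall t, 0 <= g t} ->
  (\int[mu]_(t in `[(i.+1%:R)^-1%R, i.+1%:R%R]) (g t)%:E)%E @[i --> \oo] -->
  (\int[mu]_(t in `]0%R, +oo[) (g t)%:E)%E.
Proof.
move=> mg g0; rewrite -bigcup_itv_inv_succ.
apply: ge0_nondecreasing_set_cvg_integral.
- move=> i j ij; apply/subsetPset/subset_itv; rewrite bnd_simp.
    by rewrite lef_pV2 ?posrE ?ltr0n// ler_nat ltnS.
  by rewrite ler_nat ltnS.
- by move=> i; exact: measurable_itv.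
- by move=> i; apply/measurable_EFinP; apply: measurable_funTS.
- move=> i t /=; rewrite in_itv/= => /andP[it _]; rewrite lee_fin g0//.
  by rewrite in_itv/= andbT (lt_le_trans _ it)// invr_gt0 ltr0n.
Qed.

End FTC.

Section GammaIntegral.
Variable R : realType.
Notation mu := (@lebesgue_measure R).
Implicit Types x y t : R.

Let mD (i : interval R) : measurable ([set` i] : set (measurableTypeR R)).
Proof. exact: measurable_itv. Qed.

Definition gamma_integrand x t : R := t `^ (x - 1) * expR (- t).

(** The value is kept in the extended reals because the functional equation is proved first, and
    finiteness for small [x] is then deduced from it. *)
Definition eGamma x : \bar R :=
  (\int[mu]_(t in `]0%R, +oo[) (gamma_integrand x t)%:E)%E.

Lemma GammaE x : Gamma x = fine (eGamma x).
Proof. by []. Qed.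

Lemma gamma_integrand_ge0 x t : 0 <= gamma_integrand x t.
Proof. by rewrite mulr_ge0 ?powR_ge0 ?expR_ge0. Qed.

Lemma measurable_gamma_integrand x : measurable_fun setT (gamma_integrand x).
Proof.
apply: measurable_funM; first exact: measurable_powR.
by apply: measurableT_comp => //; exact: measurable_oppr.
Qed.

Let megamma x (D : set R) : measurable_fun D (EFin \o gamma_integrand x).
Proof. by apply/measurable_EFinP; apply: measurable_funTS; exact: measurable_gamma_integrand. Qed.

Lemma eGamma_ge0 x : (0 <= eGamma x)%E.
Proof. by apply: integral_ge0 => t _; rewrite lee_fin gamma_integrand_ge0. Qed.

Lemma cvg_eGamma x :
  (\int[mu]_(t in `[(i.+1%:R)^-1%R, i.+1%:R%R]) (gamma_integrand x t)%:E)%E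
  @[i --> \oo] --> eGamma x.
Proof.
apply: cvg_integral_0y; first exact: measurable_gamma_integrand.
by move=> t _; exact: gamma_integrand_ge0.
Qed.

(** Integration by parts in differential form: integrated over a segment, it relates the gamma
    integrals at [x] and [x + 1]. *)
Lemma is_derive_gamma_integrand x t : 0 < t ->
  is_derive t 1 (gamma_integrand (x + 1))
    (x * gamma_integrand x t - gamma_integrand (x + 1) t).
Proof.
move=> t0; have h := is_derive1_powR x t0.
rewrite /gamma_integrand addrK.
apply: is_derive_eq; rewrite /GRing.scale/=; ring.
Qed.

Lemma continuous_gamma_integrand x t : 0 < t ->
  {for t, continuous (gamma_integrand x)}.
Proof.
move=> t0; rewrite -(subrK 1 x).
exact: is_derive_continuous (is_derive_gamma_integrand _ t0).
Qed.

Lemma cvg_gamma_integrandy x : gamma_integrand x i.+1%:R @[i --> \oo] --> 0.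
Proof.
(* The term of degree [m + 1] in the exponential series beats the power [x - 1 <= m] by one factor,
   which leaves a multiple of [harmonic]. *)
pose m := (Num.truncn x).+1.
have xm : x - 1 <= m%:R by rewrite lerBlDr (le_trans (ltW (truncnS_gt _)))// lerDl.
apply: (@squeeze_cvgr _ _ _ _ (fun=> 0) (fun i => m.+1`!%:R * harmonic i)).
- near=> i; rewrite gamma_integrand_ge0/= /gamma_integrand expRN.
  rewrite ler_pdivrMr ?expR_gt0//.
  have h1 : i.+1%:R `^ (x - 1) <= i.+1%:R ^+ m :> R.
    by rewrite -powR_mulrn ?ler0n// ler_powR ?ler1n.
  apply: (le_trans h1).
  have := @expR_ge1Dxn R i.+1%:R m (ler0n _ _).
  move=> h2; have h3 : i.+1%:R ^+ m.+1 / m.+1`!%:R <= expR (i.+1%:R : R) by lra.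
  move: h3; rewrite ler_pdivrMr ?ltr0n ?fact_gt0// exprS => h3.
  have i0 : (0 : R) < i.+1%:R by rewrite ltr0n.
  by rewrite /harmonic/= mulrAC ler_pdivlMr// mulrC (le_trans h3)// mulrC.
- exact: cvg_cst.
- rewrite -[X in _ --> X](mulr0 (m.+1`!%:R)).
  by apply: cvgMr; exact: cvg_harmonic.
Unshelve. all: by end_near. Qed.

Lemma cvg_gamma_integrand0 x : 1 < x ->
  gamma_integrand x (i.+1%:R)^-1 @[i --> \oo] --> 0.
Proof.
move=> x1.
apply: (@squeeze_cvgr _ _ _ _ (fun=> 0) (fun i => (i.+1%:R^-1) `^ (x - 1))).
- near=> i; rewrite gamma_integrand_ge0/= /gamma_integrand.
  by rewrite ler_piMr ?powR_ge0// expR_le1 oppr_le0 invr_ge0 ler0n.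
- exact: cvg_cst.
- have /cvg_at_rightP := @powR_cvg0 R (x - 1) ltac:(by rewrite subr_gt0).
  apply; split; last exact: cvg_harmonic.
  by move=> i; rewrite invr_gt0 ltr0n.
Unshelve. all: by end_near. Qed.

Lemma integrable_gamma_integrand_cc x a b : 0 < a ->
  mu.-integrable `[a, b] (EFin \o gamma_integrand x).
Proof.
move=> a0; apply: continuous_compact_integrable; first exact: segment_compact.
apply: continuous_in_subspaceT => t; rewrite inE/= in_itv/= => /andP[at_ _].
exact: continuous_gamma_integrand (lt_le_trans a0 at_).
Qed.

Lemma integral_gamma_integrand_cc x a b : 0 < a -> a < b ->
  (\int[mu]_(t in `[a, b]) (gamma_integrand (x + 1) t)%:E =
   x%:E * \int[mu]_(t in `[a, b]) (gamma_integrand x t)%:E -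
   (gamma_integrand (x + 1) b - gamma_integrand (x + 1) a)%:E)%E.
Proof.
move=> a0 ab.
have i1 := integrable_gamma_integrand_cc (x + 1) b a0.
have i0 := integrable_gamma_integrand_cc x b a0.
have ix : mu.-integrable `[a, b] (EFin \o (fun t => x * gamma_integrand x t)).
  by have := integrableZl (mD _) x i0.
rewrite -(@FTC2_is_derive _ (fun t => x * gamma_integrand x t - gamma_integrand (x + 1) t))//; last 2 first.
- move=> t; rewrite in_itv/= => /andP[at_ _].
  exact: is_derive_gamma_integrand (lt_le_trans a0 at_).
- move=> t; rewrite in_itv/= => /andP[at_ _].
  have t0 := lt_le_trans a0 at_.
  apply: continuousB; last exact: continuous_gamma_integrand.
  by apply: continuousM; [exact: cst_continuous|exact: continuous_gamma_integrand].
rewrite integralB_EFin//=.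
rewrite -(integralZl (mD _) i0)/=.
have fx := integrable_fin_num (mD _) ix; have f1 := integrable_fin_num (mD _) i1.
rewrite /= in fx f1; rewrite -(fineK fx) -(fineK f1).
by rewrite -!EFinB; congr EFin; rewrite opprB addrCA subrr addr0.
Qed.

Let near_gt0 : \forall i \near \oo, (0 < i)%N.
Proof. by exists 1%N. Qed.

Let inv_succ_lt i : (0 < i)%N -> (i.+1%:R : R)^-1 < i.+1%:R.
Proof.
move=> i0; apply: (@lt_trans _ _ 1); last by rewrite ltr1n.
by rewrite invf_lt1 ?ltr0n// ltr1n.
Qed.

(** Limit of [integral_gamma_integrand_cc]; the boundary term at 0 vanishes because [x + 1 > 1]. *)
Lemma eGammaS x : 0 < x -> eGamma (x + 1) = (x%:E * eGamma x)%E.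
Proof.
move=> x0; rewrite -(cvg_lim _ (@cvg_eGamma (x + 1)))//; apply/cvg_lim => //.
have h : (x%:E * \int[mu]_(t in `[(i.+1%:R)^-1%R, i.+1%:R%R]) (gamma_integrand x t)%:E -
    (gamma_integrand (x + 1) i.+1%:R - gamma_integrand (x + 1) (i.+1%:R)^-1)%:E)%E
    @[i --> \oo] --> (x%:E * eGamma x - 0)%E.
  apply: cvgeB.
  - by rewrite oppe0 fin_num_adde_defl.
  - by apply: cvgeZl => //; exact: cvg_eGamma.
  - apply: cvg_EFin; first by near=> i.
    rewrite -[X in _ --> X](subrr 0); apply: cvgB.
      exact: cvg_gamma_integrandy.
    by apply: cvg_gamma_integrand0; rewrite ltrDr.
rewrite sube0 in h; apply: cvg_trans h.
apply: near_eq_cvg; near=> i.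
rewrite -integral_gamma_integrand_cc ?invr_gt0 ?ltr0n//.
by apply: inv_succ_lt; near: i; exact: near_gt0.
Unshelve. all: by end_near. Qed.

Lemma eGamma1 : eGamma 1 = 1%E.
Proof.
rewrite -(cvg_lim _ (@cvg_eGamma 1))//; apply/cvg_lim => //.
have h : (gamma_integrand 1 (i.+1%:R)^-1 - gamma_integrand 1 i.+1%:R)%:E
    @[i --> \oo] --> 1%:E.
  apply: cvg_EFin; first by near=> i.
  rewrite -[X in _ --> X]subr0; apply: cvgB; last exact: cvg_gamma_integrandy.
  rewrite /gamma_integrand subrr; under eq_fun do rewrite powRr0 mul1r.
  suff: expR (- (i.+1%:R)^-1) @[i --> \oo] --> expR (- 0 : R) by rewrite oppr0 expR0.
  apply: (@cvg_comp _ _ _ (fun i : nat => - (i.+1%:R)^-1) (@expR R)).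
    by apply: cvgN; exact: cvg_harmonic.
  exact: continuous_expR.
apply: cvg_trans h; apply: near_eq_cvg; near=> i.
have i0 : (0 < i)%N by near: i; exact: near_gt0.
(* At [x = 0] the integral on the right of the relation has coefficient 0, so only the boundary
   terms remain. *)
have := @integral_gamma_integrand_cc 0 (i.+1%:R^-1) i.+1%:R.
rewrite invr_gt0 ltr0n => /(_ isT (inv_succ_lt i0)); rewrite add0r => ->.
by rewrite mul0e sub0e -EFinN opprB.
Unshelve. all: by end_near. Qed.

Lemma eGamma_nat n : eGamma n.+1%:R = (n`!%:R)%:E.
Proof.
elim: n => [|n IH]; first exact: eGamma1.
by rewrite -natr1 eGammaS ?ltr0n// IH -EFinM -natrM factS.
Qed.

(** For arguments at least 1 the integrand is dominated by the sum of those at 1 and at a larger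
    integer, by the first when [t <= 1] and by the second otherwise. Smaller arguments are reached
    through the functional equation. *)
Lemma eGamma_lty x : 0 < x -> (eGamma x < +oo)%E.
Proof.
have main y : 1 <= y -> (eGamma y < +oo)%E.
  move=> y1; pose m := (Num.truncn y).+1.
  have ym : y <= m.+1%:R by apply/ltW/(lt_trans (truncnS_gt _)); rewrite ltr_nat.
  apply: (@le_lt_trans _ _ (eGamma 1 + eGamma m.+1%:R)%E); last first.
    by rewrite eGamma1 eGamma_nat -EFinD ltry.
  rewrite /eGamma -ge0_integralD//=; last 4 first.
  - by move=> t _; rewrite lee_fin gamma_integrand_ge0.
  - exact: megamma.
  - by move=> t _; rewrite lee_fin gamma_integrand_ge0.
  - exact: megamma.
  apply: ge0_le_integral => //=.
  - by move=> t _; rewrite lee_fin gamma_integrand_ge0.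
  - exact: megamma.
  - by apply: emeasurable_funD; exact: megamma.
  - move=> t; rewrite in_itv/= andbT => t0.
    rewrite -EFinD lee_fin /gamma_integrand -mulrDl ler_wpM2r ?expR_ge0//.
    rewrite subrr powRr0; have [t1|t1] := leP t 1.
      apply: (@le_trans _ _ 1); last by rewrite lerDl powR_ge0.
      by rewrite -[leRHS](powRr0 t) ger_powR ?t0// subr_ge0.
    apply: (@le_trans _ _ (t `^ (m.+1%:R - 1))); last by rewrite lerDr.
    by rewrite ler_powR ?lerD2r// ltW.
move=> x0; have := main (x + 1) ltac:(by rewrite lerDr ltW).
rewrite eGammaS// => h; move: (eGamma_ge0 x) h.
by case: (eGamma x) => [r||]//= _; rewrite ?ltry// mulry gtr0_sg// mul1e.
Qed.

Lemma integrable_gamma_integrand x : 0 < x ->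
  mu.-integrable `]0, +oo[ (EFin \o gamma_integrand x).
Proof.
move=> x0; apply/integrableP; split.
  exact: megamma.
under eq_integral do rewrite /= ger0_norm ?gamma_integrand_ge0//.
exact: eGamma_lty.
Qed.

Lemma GammaS x : 0 < x -> Gamma (x + 1) = x * Gamma x.
Proof.
move=> x0; rewrite !GammaE eGammaS// fineM//.
by rewrite ge0_fin_numE ?eGamma_ge0 ?eGamma_lty.
Qed.

Lemma Gamma_nat n : Gamma n.+1%:R = n`!%:R :> R.
Proof. by rewrite GammaE eGamma_nat. Qed.

Lemma Gamma_ge0 x : 0 <= Gamma x.
Proof. by rewrite GammaE fine_ge0 ?eGamma_ge0. Qed.

(** Concavity of [t ^ x]: the right side is the tangent line at [m]. *)
Lemma powR_le_tangent x t m : 0 < x < 1 -> 0 < t -> 0 < m ->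
  t `^ x <= (1 - x) * m `^ x + x * m `^ (x - 1) * t.
Proof.
move=> /andP[x0 x1] t0 m0.
have m00 : m != 0 by rewrite gt_eqF.
rewrite powRB ?m00 ?implybT// powRr1 ?(ltW m0)//.
pose s := t / m; have s0 : 0 < s by rewrite divr_gt0.
have -> : t = m * s by rewrite /s mulrC divfK.
rewrite powRM ?(ltW m0) ?(ltW s0)//.
have -> : (1 - x) * m `^ x + x * (m `^ x / m) * (m * s) = m `^ x * (1 - x + x * s).
  by field.
rewrite ler_pM2l ?powR_gt0//.
(* After scaling, the claim is [s ^ x <= w]. It is the combination, with weights [x] and [1 - x], of
   [ln y <= y - 1] at [y = s / w] and at [y = 1 / w]; the right sides then add up to 0. *)
set w := 1 - x + x * s; have w0 : 0 < w.
  by rewrite /w; have := mulr_gt0 x0 s0; lra.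
rewrite /powR gt_eqF// -[leRHS]lnK ?posrE// ler_expR.
have h1 : ln (s / w) <= s / w - 1.
  by have := @le_ln1Dx R (s / w - 1); rewrite addrCA subrr addr0; apply; rewrite ltrBrDr addNr divr_gt0.
have h2 : ln w^-1 <= w^-1 - 1.
  by have := @le_ln1Dx R (w^-1 - 1); rewrite addrCA subrr addr0; apply; rewrite ltrBrDr addNr invr_gt0.
rewrite ln_div ?posrE// in h1; rewrite lnV ?posrE// in h2.
have h3 : x * (s / w - 1) + (1 - x) * (w^-1 - 1) = 0.
  by rewrite /w; field; rewrite -/w gt_eqF.
have h4 : x * (ln s - ln w) <= x * (s / w - 1) by rewrite ler_wpM2l// ltW.
have h5 : (1 - x) * - ln w <= (1 - x) * (w^-1 - 1) by rewrite ler_wpM2l// subr_ge0 ltW.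
lra.
Qed.

(** Log-convexity between [m] and [m + 1], from the tangent line at the point [m]: with this choice
    [Gamma (m + 1) = m * Gamma m] recombines the two terms into one. *)
Lemma Gamma_le_powR x m : 0 < x < 1 -> 0 < m -> Gamma (m + x) <= m `^ x * Gamma m.
Proof.
move=> x01 m0; have /andP[x0 x1] := x01.
have m00 : m != 0 by rewrite gt_eqF.
have im := integrable_gamma_integrand m0.
have im1 := integrable_gamma_integrand (addr_gt0 m0 ltr01).
have -> : m `^ x * Gamma m = (1 - x) * m `^ x * Gamma m + x * m `^ (x - 1) * Gamma (m + 1).
  rewrite GammaS// powRB ?m00 ?implybT// powRr1 ?(ltW m0)//; by field.
rewrite /Gamma -/(gamma_integrand _ _).
have e1 : mu.-integrable `]0, +oo[ (EFin \o (fun t => (1 - x) * m `^ x * gamma_integrand m t)).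
  by have := integrableZl (mD _) ((1 - x) * m `^ x) im.
have e2 : mu.-integrable `]0, +oo[ (EFin \o (fun t => x * m `^ (x - 1) * gamma_integrand (m + 1) t)).
  by have := integrableZl (mD _) (x * m `^ (x - 1)) im1.
rewrite -!RintegralZl// -RintegralD//.
apply: le_Rintegral => //.
- exact: integrable_gamma_integrand (addr_gt0 m0 x0).
- by have := integrableD (mD _) e1 e2.
- move=> t /=; rewrite in_itv/= andbT => t0.
  rewrite /gamma_integrand addrK !mulrA -mulrDl ler_wpM2r ?expR_ge0//.
  have tE : t `^ m = t `^ (m - 1) * t.
    rewrite -{3}(powRr1 (ltW t0)) -powRD ?subrK//.
    by rewrite gt_eqF ?implybT.
  rewrite tE addrAC [t `^ (m - 1 + x)]powRD; last by rewrite (gt_eqF t0) implybT.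
  have := @powR_le_tangent x t m x01 t0 m0 => /(ler_wpM2l (powR_ge0 t (m - 1))).
  by move=> /le_trans; apply; rewrite le_eqVlt; apply/orP; left; apply/eqP; ring.
Qed.

End GammaIntegral.

(** * Euler's limit and the digamma function *)

Section Preliminaries.
Variable R : realType.

Lemma cvg_harmonic_bound (u : R^nat) (l C : R) :
  (forall i, `|u i - l| <= C * harmonic i) -> u @ \oo --> l.
Proof.
move=> h; apply/subr_cvg0.
apply: norm_cvg0.
apply: (@squeeze_cvgr _ _ _ _ (fun=> 0) (fun i => C * harmonic i)).
- by near=> i; rewrite normr_ge0 h.
- exact: cvg_cst.
- rewrite -[X in _ --> X](mulr0 C); apply: cvgMr; exact: cvg_harmonic.
Unshelve. all: by end_near. Qed.

(** Both bounds are [ln y <= y - 1], at [y = (a + h) / a] and at its inverse. The increment [h] may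
    be negative. *)
Lemma ln_bounds (a h : R) : 0 < a -> 0 < a + h ->
  h / (a + h) <= ln (a + h) - ln a <= h / a.
Proof.
move=> a0 ah0; rewrite -ln_div ?posrE//.
have a00 : a != 0 by rewrite gt_eqF.
have ah00 : a + h != 0 by rewrite gt_eqF.
apply/andP; split; last first.
  have -> : (a + h) / a = 1 + h / a by field.
  apply: le_ln1Dx.
  have -> : h / a = (a + h) / a - 1 by field.
  by rewrite ltrBrDr addNr divr_gt0.
rewrite -[leRHS]opprK -lnV ?posrE ?divr_gt0// invf_div lerNr.
have -> : a / (a + h) = 1 + - (h / (a + h)) by field.
apply: le_ln1Dx.
have -> : - (h / (a + h)) = a / (a + h) - 1 by field.
by rewrite ltrBrDr addNr divr_gt0.
Qed.

Lemma ln_prod (F : nat -> R) n : (forall k, 0 < F k) ->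
  ln (\prod_(0 <= k < n) F k) = \sum_(0 <= k < n) ln (F k).
Proof.
move=> F0; elim: n => [|n IH]; first by rewrite !big_nil ln1.
by rewrite !big_nat_recr//= lnM ?posrE ?prodr_gt0// IH.
Qed.

(** A remainder bound of this form passes to pointwise limits, so a derivative can be transferred
    from approximations to their limit. *)
Lemma is_derive_quadratic_remainder (f : R -> R) (x l C d : R) : 0 < d ->
  (forall h, `|h| < d -> `|f (x + h) - f x - h * l| <= C * h ^+ 2) ->
  is_derive x 1 f l.
Proof.
move=> d0 H.
have C0 : 0 <= C.
  have d2 : 0 < (d / 2) ^+ 2 by apply: exprn_gt0; apply: divr_gt0.
  have dd : `|d / 2| < d by rewrite ger0_norm; lra.
  by have := le_trans (normr_ge0 _) (H _ dd); rewrite (pmulr_lge0 _ d2).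
have C1 : 0 < C + 1 by lra.
have lim : (fun h => h^-1 *: ((f \o shift x) (h *: (1 : R)) - f x)) @ 0^' --> l.
  apply/cvgrPdist_le => e e0; near=> h.
  have h0 : h != 0 by near: h; exact: nbhs_dnbhs_neq.
  have hd : `|h| < d by near: h; exact: dnbhs0_lt.
  have he : `|h| <= e / (C + 1) by near: h; apply: dnbhs0_le; rewrite divr_gt0.
  have Hh := H h hd; rewrite /= /GRing.scale/= mulr1 [h + x]addrC distrC.
  have -> : h^-1 * (f (x + h) - f x) - l = (f (x + h) - f x - h * l) / h by field.
  rewrite normrM normfV ler_pdivrMr ?normr_gt0//.
  apply: (le_trans Hh); rewrite -[h ^+ 2]real_normK ?num_real// expr2 mulrA ler_wpM2r//.
  rewrite ler_pdivlMr in he; last lra.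
  apply: le_trans he; rewrite mulrC ler_wpM2l//; lra.
apply: DeriveDef; first by apply/cvg_ex; exists l.
exact: cvg_lim lim.
Unshelve. all: by end_near. Qed.

Lemma is_derive_cosM (a t : R) : is_derive t 1 (fun t => cos (a * t)) (- a * sin (a * t)).
Proof.
have h := is_derive1_comp (is_derive_cos (a * t)) (is_deriveZ a (is_derive_id t 1)).
apply: (is_derive_eq h); rewrite /GRing.scale/=; ring.
Qed.

Lemma is_derive_sinM (a t : R) : is_derive t 1 (fun t => sin (a * t)) (a * cos (a * t)).
Proof.
have h := is_derive1_comp (is_derive_sin (a * t)) (is_deriveZ a (is_derive_id t 1)).
apply: (is_derive_eq h); rewrite /GRing.scale/=; ring.
Qed.

(** Telescoping of [1 / (y + 1) ^ 2 <= 1 / y - 1 / (y + 1)]. What matters is that the bound is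
    independent of [n]. *)
Lemma sum_inv_sqr_le (x : R) n : 0 < x ->
  \sum_(0 <= k < n) ((x + k%:R) ^+ 2)^-1 <= (x ^+ 2)^-1 + x^-1.
Proof.
move=> x0; case: n => [|n].
  by rewrite big_nil addr_ge0 ?invr_ge0 ?exprn_ge0 ?ltW.
rewrite big_nat_recl//= addr0 lerD2l.
have -> : x^-1 = x^-1 - (x + 0%:R)^-1 + (x + 0%:R)^-1 by rewrite subrK.
suff : \sum_(0 <= k < n) ((x + k.+1%:R) ^+ 2)^-1 <= x^-1 - (x + n%:R)^-1.
  move=> /le_trans; apply; rewrite addr0 subrK gerBl invr_ge0; have := ler0n R n; lra.
elim: n => [|n IH]; first by rewrite big_nil addr0 subrr.
rewrite big_nat_recr//=; apply: (le_trans (lerD IH (lexx _))).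
rewrite -natr1 addrA; set y := x + n%:R.
have y0 : 0 < y by rewrite /y; have := ler0n R n; lra.
have y1 : 0 < y + 1 by lra.
rewrite -lerBrDl.
have -> : x^-1 - (y + 1)^-1 - (x^-1 - y^-1) = (y * (y + 1))^-1.
  by field; rewrite !gt_eqF.
by rewrite lef_pV2 ?posrE ?mulr_gt0 ?exprn_gt0// expr2 ler_wpM2r//; lra.
Qed.

End Preliminaries.

Section EulerLimit.
Variable R : realType.
Implicit Types x : R.

(** A zero at [x] would propagate to [1 + x], and then log-convexity would bound [Gamma 2 = 1] by
    0. *)
Lemma Gamma_gt0 x : 0 < x < 1 -> 0 < Gamma x.
Proof.
move=> /andP[x0 x1]; rewrite lt_neqAle Gamma_ge0 andbT eq_sym; apply/eqP => G0.
have := @Gamma_le_powR R (1 - x) (1 + x) ltac:(lra) ltac:(lra).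
have -> : 1 + x + (1 - x) = 2 :> R by ring.
by rewrite (Gamma_nat R 1) [1 + x]addrC GammaS// G0 !mulr0 lern0 eqn0Ngt fact_gt0.
Qed.

Lemma Gamma_addn x n : 0 < x ->
  Gamma (x + n%:R) = \prod_(0 <= k < n) (x + k%:R) * Gamma x.
Proof.
move=> x0; elim: n => [|n IH]; first by rewrite addr0 big_nil mul1r.
rewrite -natr1 addrA GammaS; last by have := ler0n R n; lra.
by rewrite IH big_nat_recr//= mulrCA mulrA.
Qed.

(** Logarithm of Euler's approximation [(K + 1) ^ x K! / (x (x + 1) ... (x + K))]. *)
Definition lnGamma_approx K x : R :=
  x * ln K.+1%:R + ln K`!%:R - \sum_(0 <= k < K.+1) ln (x + k%:R).

(** The derivative of [lnGamma_approx K] in [x]. *)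
Definition digamma_approx K x : R :=
  ln K.+1%:R - \sum_(0 <= k < K.+1) (x + k%:R)^-1.

Let xk_gt0 x k : 0 < x -> 0 < x + k%:R.
Proof. by move=> x0; have := ler0n R k; lra. Qed.

(** [Gamma (K + 1 + x)] is squeezed by two uses of [Gamma_le_powR]: from [K + 1] up by [x], and from
    [K + 1 + x] up by [1 - x]. Replacing [K + 1 + x] by [K + 1] in the second power costs at most
    [(1 - x) x / (K + 1)]. *)
Lemma lnGamma_approx_bounds x K : 0 < x < 1 ->
  lnGamma_approx K x - harmonic K <= ln (Gamma x) <= lnGamma_approx K x.
Proof.
move=> x01; have /andP[x0 x1] := x01; have G0 := Gamma_gt0 x01.
have K0 : (0 : R) < K.+1%:R by rewrite ltr0n.
have Kx0 : 0 < K.+1%:R + x by rewrite addr_gt0.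
have x01' : 0 < 1 - x < 1 by rewrite subr_gt0 x1 gtrBl.
have xle1 : (1 - x) * x <= 1.
  by rewrite mulr_ile1 ?subr_ge0 ?gerBl ?(ltW x0) ?(ltW x1).
have up := @Gamma_le_powR R x K.+1%:R x01 K0.
have low := @Gamma_le_powR R (1 - x) (K.+1%:R + x) x01' Kx0.
have Kxx : K.+1%:R + x + (1 - x) = K.+2%:R :> R by rewrite addrACA subrr addr0 natr1.
have /andP[_ lnK1] := @ln_bounds R K.+1%:R x K0 Kx0.
have lnKfact : ln K.+1`!%:R = ln K.+1%:R + ln K`!%:R :> R.
  by rewrite factS natrM lnM ?posrE ?ltr0n ?fact_gt0.
have Gprod : Gamma (K.+1%:R + x) = \prod_(0 <= k < K.+1) (x + k%:R) * Gamma x.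
  by rewrite addrC Gamma_addn.
have P0 : 0 < \prod_(0 <= k < K.+1) (x + k%:R).
  by apply: prodr_gt0 => k _; exact: xk_gt0.
have GK0 : 0 < Gamma (K.+1%:R + x) by rewrite Gprod mulr_gt0.
have lnG : ln (Gamma (K.+1%:R + x)) = \sum_(0 <= k < K.+1) ln (x + k%:R) + ln (Gamma x).
  by rewrite Gprod lnM ?posrE// ln_prod// => k; exact: xk_gt0.
have ln_up : ln (Gamma (K.+1%:R + x)) <= x * ln K.+1%:R + ln K`!%:R.
  have f0 : (0 : R) < K`!%:R by rewrite ltr0n fact_gt0.
  have p0 := powR_gt0 x K0.
  rewrite Gamma_nat -(ler_ln GK0 (mulr_gt0 p0 f0)) (lnM p0 f0) ln_powR in up.
  exact: up.
have ln_low : ln K.+1`!%:R <= (1 - x) * ln (K.+1%:R + x) + ln (Gamma (K.+1%:R + x)).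
  have f0 : (0 : R) < K.+1`!%:R by rewrite ltr0n fact_gt0.
  have p0 := powR_gt0 (1 - x) Kx0.
  rewrite Kxx Gamma_nat -(ler_ln f0 (mulr_gt0 p0 GK0)) (lnM p0 GK0) ln_powR in low.
  exact: low.
have lnK2 : (1 - x) * (ln (K.+1%:R + x) - ln K.+1%:R) <= harmonic K.
  have /andP[/ltW x1' _] := x01'.
  apply: (le_trans (ler_wpM2l x1' lnK1)).
  by rewrite mulrA ler_piMl// invr_ge0 ltW.
move: ln_up ln_low lnK2; rewrite /lnGamma_approx lnKfact lnG.
move: (ln (K.+1%:R + x)) (ln K.+1%:R) (ln K`!%:R) (harmonic K) (ln (Gamma x)).
move: (\sum_(0 <= k < K.+1) ln (x + k%:R)); clear=> S a b c h g h1 h2 h3.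
by apply/andP; split; lra.
Qed.

Lemma cvg_lnGamma_approx x : 0 < x < 1 ->
  lnGamma_approx K x @[K --> \oo] --> ln (Gamma x).
Proof.
move=> x01; apply: (@cvg_harmonic_bound _ _ _ 1) => K.
have /andP[h1 h2] := lnGamma_approx_bounds K x01.
rewrite mul1r ger0_norm; lra.
Qed.

Lemma is_cvg_digamma_approx x : 0 < x -> cvgn (digamma_approx ^~ x).
Proof.
move=> x0.
(* With [ln (x + K + 1)] in place of [ln (K + 1)] the sequence is nonincreasing, and its decrements
   are bounded by telescoping differences of inverses. The change of logarithm is at most
   [x / (K + 1)]. *)
pose u K := ln (x + K.+1%:R) - \sum_(0 <= k < K.+1) (x + k%:R)^-1.
have uS K : u K.+1 - u K = ln (x + K.+1%:R + 1) - ln (x + K.+1%:R) - (x + K.+1%:R)^-1.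
  by rewrite /u [in \sum_(_ <= _ < K.+2) _]big_nat_recr//= -[K.+2%:R]natr1 addrA; ring.
have ub K : (x + K.+2%:R)^-1 - (x + K.+1%:R)^-1 <= u K.+1 - u K <= 0.
  have E : x + K.+1%:R + 1 = x + K.+2%:R by rewrite -addrA natr1.
  have := @ln_bounds R (x + K.+1%:R) 1 (xk_gt0 _ x0).
  rewrite E => /(_ (xk_gt0 _ x0)) /andP[h1 h2].
  rewrite uS E; rewrite !mul1r in h1 h2.
  by apply/andP; split; [rewrite lerD2r|rewrite subr_le0].
have cu : cvgn u.
  apply: nonincreasing_is_cvgn.
    by apply/nonincreasing_seqP => n; have := ub n; lra.
  exists (u 0 - x^-1) => _ [n _ <-].
  have h : u 0 + (x + n.+1%:R)^-1 - (x + 1%:R)^-1 <= u n.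
    elim: n => [|n IH]; first by rewrite addrK.
    by have := ub n; lra.
  have h1 : (0 : R) <= (x + n.+1%:R)^-1 by rewrite invr_ge0 ltW ?xk_gt0.
  have h2 : (x + 1%:R)^-1 <= x^-1 by rewrite lef_pV2 ?posrE ?xk_gt0//; lra.
  lra.
have cv : digamma_approx K x - u K @[K --> \oo] --> 0.
  apply: (@cvg_harmonic_bound _ _ _ x) => K.
  have K0 : (0 : R) < K.+1%:R by rewrite ltr0n.
  have := @ln_bounds R K.+1%:R x K0 ltac:(lra).
  rewrite subr0 /digamma_approx /u /harmonic/= [K.+1%:R + x]addrC => /andP[h1 h2].
  have h3 : 0 <= x / (x + K.+1%:R) by rewrite divr_ge0 ?ltW ?xk_gt0.
  move: (le_trans h3 h1) h2; set A := ln (x + _); set B := ln _.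
  by set S := \sum_(_ <= _ < _) _; set C := x / _ => h1' h2; rewrite ler0_norm; lra.
apply/cvg_ex; exists (0 + limn u).
have -> : digamma_approx ^~ x = (fun K => (digamma_approx K x - u K) + u K).
  by apply/funext => K; rewrite subrK.
exact: cvgD.
Qed.

(** With [y = x + k], each term of the remainder is in absolute value at most [h / y - h / (y + h)],
    hence at most [2 h ^ 2 / y ^ 2] since [|h| <= y / 2]. Summing gives a constant free of [K]. *)
Lemma lnGamma_approx_taylor K x h : 0 < x -> `|h| <= x / 2 ->
  `|lnGamma_approx K (x + h) - lnGamma_approx K x - h * digamma_approx K x| <=
  2 * ((x ^+ 2)^-1 + x^-1) * h ^+ 2.
Proof.
move=> x0 hx; have {}hx : - (x / 2) <= h <= x / 2 by rewrite -ler_norml.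
have -> : lnGamma_approx K (x + h) - lnGamma_approx K x - h * digamma_approx K x =
    - \sum_(0 <= k < K.+1) (ln (x + k%:R + h) - ln (x + k%:R) - h / (x + k%:R)).
  rewrite /lnGamma_approx /digamma_approx !sumrB -mulr_sumr.
  under [in RHS]eq_bigr do rewrite addrAC.
  ring.
rewrite normrN; apply: (le_trans (ler_norm_sum _ _ _)).
apply: (@le_trans _ _ (\sum_(0 <= k < K.+1) 2 * h ^+ 2 * ((x + k%:R) ^+ 2)^-1)).
  apply: ler_sum_nat => k _.
  set y := x + k%:R.
  have yx : x <= y by rewrite lerDl.
  have y0 : 0 < y by lra.
  have yh0 : 0 < y + h by lra.
  have /andP[h1 h2] := @ln_bounds R y h y0 yh0.
  rewrite ler0_norm; last lra.
  apply: (@le_trans _ _ (h / y - h / (y + h))); first lra.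
  have -> : h / y - h / (y + h) = h ^+ 2 * (y * (y + h))^-1.
    by field; rewrite !gt_eqF.
  have -> : 2 * h ^+ 2 / y ^+ 2 = h ^+ 2 * (2 / y ^+ 2) by ring.
  rewrite ler_wpM2l ?sqr_ge0//.
  rewrite -[leLHS]mul1r.
  have p1 : 0 < y * (y + h) by rewrite mulr_gt0.
  have p2 : 0 < y ^+ 2 by rewrite exprn_gt0.
  rewrite ler_pdivrMr// mulrAC ler_pdivlMr// mul1r.
  by rewrite expr2 mulrCA ler_wpM2l//; lra.
rewrite -mulr_sumr [leRHS]mulrAC ler_wpM2l ?(mulr_ge0 _ (sqr_ge0 h))//.
exact: sum_inv_sqr_le.
Qed.

Lemma is_derive_lnGamma x : 0 < x < 1 ->
  is_derive x 1 (fun y => ln (Gamma y)) (limn (digamma_approx ^~ x)).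
Proof.
move=> x01; have /andP[x0 x1] := x01.
(* The radius keeps [x + h] in the interval where the limit is known, and [h] within the range of
   the Taylor bound. *)
apply: (@is_derive_quadratic_remainder _ _ _ _ (2 * ((x ^+ 2)^-1 + x^-1))
  (Num.min (x / 2) (1 - x))); first by rewrite lt_min; lra.
move=> h; rewrite lt_min => /andP[hx h1x].
have xh01 : 0 < x + h < 1 by have := ler_norm h; have := ler_norm (- h); rewrite normrN; lra.
set l := limn _.
have cv : `|lnGamma_approx K (x + h) - lnGamma_approx K x - h * digamma_approx K x|
   @[K --> \oo] --> `|ln (Gamma (x + h)) - ln (Gamma x) - h * l|.
  apply: cvg_norm; apply: cvgB; first by apply: cvgB; exact: cvg_lnGamma_approx.
  by apply: cvgMr; exact: is_cvg_digamma_approx.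
apply: (ler_cvg_to cv (cvg_cst _)); near=> K.
by apply: lnGamma_approx_taylor => //; exact: ltW.
Unshelve. all: by end_near. Qed.

Lemma digammaE x : 0 < x < 1 -> digamma x = limn (digamma_approx ^~ x).
Proof.
move=> x01; have /andP[x0 x1] := x01; have G0 := Gamma_gt0 x01.
(* [Gamma] agrees with the exponential of its logarithm near [x], where it is positive. *)
have dG : is_derive x 1 (@Gamma R) (Gamma x * limn (digamma_approx ^~ x)).
  have := @is_derive1_comp R expR (fun y => ln (Gamma y)) x _ _ (is_derive_expR (ln (Gamma x))) (is_derive_lnGamma x01).
  rewrite lnK ?posrE//; apply: near_eq_is_derive.
  near=> y => /=; rewrite lnK// posrE Gamma_gt0//.
  apply/andP; split; near: y; [exact: lt_nbhsr|exact: lt_nbhsl].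
rewrite /digamma derive1E (@derive_val _ _ _ _ _ _ _ dG).
by rewrite mulrAC divff ?mul1r// gt_eqF.
Unshelve. all: by end_near. Qed.

Lemma cvg_digamma_approx x : 0 < x < 1 ->
  digamma_approx K x @[K --> \oo] --> digamma x.
Proof.
by move=> x01; rewrite digammaE//; apply: is_cvg_digamma_approx; case/andP: x01.
Qed.

(** [euler_gamma] is a [limn], so the existence of the limit has to be proved; up to a shift of
    index the sequence is [- digamma_approx K 1]. *)
Lemma cvg_euler_gamma :
  series (@harmonic R) m - ln (m%:R : R) @[m --> \oo] --> euler_gamma R.
Proof.
have e K : - digamma_approx K 1 = series (@harmonic R) K.+1 - ln (K.+1%:R : R).
  rewrite /digamma_approx /series/= opprB; congr (_ - _).
  by apply: eq_bigr => k _; rewrite /harmonic/= addrC natr1.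
have /cvg_ex[l hl] := is_cvg_digamma_approx (ltr01 : (0 : R) < 1).
apply/cvg_ex; exists (- l); rewrite -cvg_shiftS.
apply: cvg_trans (cvgN hl); apply: near_eq_cvg; near=> K.
by rewrite /= -e.
Unshelve. all: by end_near. Qed.

End EulerLimit.

(** * The sine product *)

Section SineProduct.
Variable R : realType.
Notation mu := (@lebesgue_measure R).
Implicit Types x t : R.

(** At [x = 0] these are Wallis's integrals. The even exponent keeps the weight nonnegative and
    makes the recursion in [K] produce the factors [1 - x ^ 2 / k ^ 2]. *)
Definition wallis K x : R :=
  \int[mu]_(t in `[0, pi / 2]) (cos (2 * x * t) * cos t ^+ K.*2).

Let mI : measurable (`[0, pi / 2]%classic : set (measurableTypeR R)).
Proof. exact: measurable_itv. Qed.

Let cont_int (f : R -> R) : continuous f -> mu.-integrable `[0, pi / 2] (EFin \o f).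
Proof.
move=> cf; apply: continuous_compact_integrable; first exact: segment_compact.
exact: continuous_subspaceT.
Qed.

Let pihalf_gt0 : 0 < pi / 2 :> R.
Proof. by rewrite divr_gt0 ?pi_gt0. Qed.

Let is_derive_cosX n t :
  is_derive t 1 (fun t => cos t ^+ n) (n%:R * cos t ^+ n.-1 * - sin t).
Proof.
have -> : (fun t : R => cos t ^+ n) = cos ^+ n by rewrite exprfctE.
exact: is_deriveX.
Qed.

Let cont_wallis K x : continuous (fun t => cos (2 * x * t) * cos t ^+ K.*2).
Proof.
move=> t; apply: cvgM; first exact: is_derive_continuous (is_derive_cosM _ _).
apply: (@continuous_comp _ _ _ cos (fun y => y ^+ K.*2)); first exact: continuous_cos.
exact: exprn_continuous.
Qed.

Let continuous_integral_FTC (f F : R -> R) : continuous f ->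
  (forall t, is_derive t 1 F (f t)) ->
  \int[mu]_(t in `[0, pi / 2]) f t = F (pi / 2) - F 0.
Proof. by move=> cf dF; rewrite /Rintegral (FTC2_is_derive pihalf_gt0 (fun t _ => dF t) (fun t _ => cf t)). Qed.

Lemma wallisS K x :
  (1 - x ^+ 2 / K.+1%:R ^+ 2) * wallis K.+1 x =
  (1 - (2 * K.+1%:R)^-1) * wallis K x.
Proof.
pose N : R := 2 * K.+1%:R.
have N0 : N != 0 by rewrite mulf_neq0// pnatr_eq0.
(* [F] vanishes at both ends of [[0, pi / 2]], so the integral of [f = F'] is 0. *)
pose F t := N * (cos (2 * x * t) * (cos t ^+ K.*2.+1 * sin t))
  - 2 * x * (sin (2 * x * t) * cos t ^+ K.*2.+2).
pose f t := (N ^+ 2 - (2 * x) ^+ 2) * (cos (2 * x * t) * cos t ^+ K.+1.*2)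
  - N * (N - 1) * (cos (2 * x * t) * cos t ^+ K.*2).
have dF t : is_derive t 1 F (f t).
  have dc := is_derive_cosM (2 * x) t; have ds := is_derive_sinM (2 * x) t.
  have d1 := is_derive_cosX K.*2.+1 t; have d2 := is_derive_cosX K.*2.+2 t.
  rewrite /F; apply: is_derive_eq.
  rewrite /f /GRing.scale/= !exprS.
  have e : sin t * sin t = 1 - cos t * cos t by rewrite -!expr2 sin2cos2.
  have -> : N = K.*2%:R + 2 by rewrite /N -natr1 -muln2 natrM; ring.
  by rewrite -!natr1; move: (cos (2 * x * t)) (sin (2 * x * t)) (cos t) (sin t) (cos t ^+ K.*2) e => C S c s P e; ring: e.
have cf : continuous f.
  by move=> t; apply: cvgB; apply: cvgM;
    [exact: cvg_cst|exact: cont_wallis|exact: cvg_cst|exact: cont_wallis].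
have := continuous_integral_FTC cf dF.
rewrite RintegralB//; last 2 first.
- by apply: cont_int => t; apply: cvgM; [exact: cvg_cst|exact: cont_wallis].
- by apply: cont_int => t; apply: cvgM; [exact: cvg_cst|exact: cont_wallis].
rewrite !RintegralZl//; try (apply: cont_int; exact: cont_wallis).
rewrite -!/(wallis _ _) /F cos_pihalf !exprS sin0 !mulr0 sin0 !mul0r !mulr0 !subr0.
move=> /eqP; rewrite subr_eq0 => /eqP e.
have e2 : wallis K.+1 x * (N ^+ 2 - (2 * x) ^+ 2) / N ^+ 2 = (N * (N - 1)) * wallis K x / N ^+ 2.
  by rewrite -e; ring.
have -> : K.+1%:R = N / 2 :> R by rewrite /N mulrAC divff ?mul1r.
apply: (etrans (y := wallis K.+1 x * (N ^+ 2 - (2 * x) ^+ 2) / N ^+ 2)).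
  by field.
by rewrite e2; field.
Qed.

Lemma wallis00 : wallis 0 0 = pi / 2.
Proof.
rewrite /wallis; under eq_Rintegral do rewrite mulr0 mul0r cos0 expr0 mulr1.
by rewrite (@continuous_integral_FTC _ id) ?subr0// => t; exact: cvg_cst.
Qed.

Lemma wallis0 x : 0 < x -> wallis 0 x = sin (pi * x) / (2 * x).
Proof.
move=> x0; have xn : 2 * x != 0 by rewrite mulf_neq0// gt_eqF.
transitivity ((2 * x)^-1 * sin (2 * x * (pi / 2)) - (2 * x)^-1 * sin (2 * x * 0)).
  apply: (continuous_integral_FTC (F := fun t => (2 * x)^-1 * sin (2 * x * t))).
    exact: cont_wallis.
  move=> t; have ds := is_derive_sinM (2 * x) t.
  by apply: is_derive_eq; rewrite /GRing.scale/= expr0; field; rewrite gt_eqF.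
rewrite !mulr0 sin0 mulr0 subr0 mulrC; congr (sin _ / _).
by field.
Qed.

Let wallisS0 K : wallis K.+1 0 = (1 - (2 * K.+1%:R)^-1) * wallis K 0.
Proof. by rewrite -wallisS expr0n/= mul0r subr0 mul1r. Qed.

Lemma wallis0_gt0 K : 0 < wallis K 0.
Proof.
elim: K => [|K IH]; first by rewrite wallis00.
rewrite wallisS0 mulr_gt0// subr_gt0 invf_lt1 ?mulr_gt0 ?ltr0n//.
have h : (1 : R) <= K.+1%:R by rewrite ler1n.
set k := K.+1%:R in h *; lra.
Qed.

Definition sine_product K x : R := \prod_(0 <= k < K) (1 - x ^+ 2 / k.+1%:R ^+ 2).

(** The recursion [wallisS] at [x] divided by the one at 0, written without quotients. *)
Lemma wallis_sine_product K x :
  wallis K x * sine_product K x * wallis 0 0 = wallis K 0 * wallis 0 x.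
Proof.
rewrite /sine_product; elim: K => [|K IH].
  by rewrite big_nil mulr1 mulrC.
rewrite big_nat_recr//= wallisS0 -[RHS]mulrA -IH.
set P := \prod_(_ <= _ < _) _.
transitivity (((1 - x ^+ 2 / K.+1%:R ^+ 2) * wallis K.+1 x) * (P * wallis 0 0)).
  by ring.
by rewrite wallisS; ring.
Qed.

(** From above, [cos (2 x t) <= 1]. From below, [cos (2 x t) = 1 - 2 sin (x t) ^ 2 >= 2 cos t ^ 2 -
    1] as [0 <= x t <= t <= pi / 2], so the ratio is at least [2 * wallis K.+1 0 / wallis K 0 - 1 =
    1 - 1 / (K + 1)]. *)
Lemma wallis_ratio K x : 0 < x < 1 ->
  `|wallis K x / wallis K 0 - 1| <= 1 * harmonic K.
Proof.
move=> /andP[x0 x1]; have W0 := wallis0_gt0 K.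
have W00 : wallis K 0 != 0 by rewrite gt_eqF.
have le1 : wallis K x <= wallis K 0.
  apply: le_Rintegral => //; try (apply: cont_int; exact: cont_wallis).
  move=> t _; rewrite ler_wpM2r//.
    by rewrite -muln2 mulnC exprM exprn_ge0// sqr_ge0.
  by rewrite mulr0 mul0r cos0 cos_le1.
have le2 : 2 * wallis K.+1 0 - wallis K 0 <= wallis K x.
  rewrite /wallis -RintegralZl//; last by apply: cont_int; exact: cont_wallis.
  rewrite -RintegralB//; last 2 first.
  - by apply: cont_int => t; apply: cvgM; [exact: cvg_cst|exact: cont_wallis].
  - by apply: cont_int; exact: cont_wallis.
  apply: le_Rintegral => //; try (apply: cont_int; exact: cont_wallis).
    apply: cont_int => t; apply: cvgB; last exact: cont_wallis.
    by apply: cvgM; [exact: cvg_cst|exact: cont_wallis].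
  move=> t; rewrite /= in_itv/= => /andP[t0 tpi].
  rewrite !mulr0 !mul0r cos0 !mul1r doubleS !exprS.
  set C := cos t ^+ K.*2.
  have C0 : 0 <= C by rewrite /C -muln2 mulnC exprM exprn_ge0// sqr_ge0.
  have -> : 2 * (cos t * (cos t * C)) - C = (2 * (cos t * cos t) - 1) * C by ring.
  rewrite ler_wpM2r//.
  have -> : 2 * x * t = (x * t) *+ 2 by rewrite mulr2n; ring.
  rewrite cos_mulr2n cos2sin2.
  have xt0 : 0 <= x * t by rewrite mulr_ge0// ltW.
  have xtt : x * t <= t by rewrite ler_piMl// ltW.
  have s0 : 0 <= sin (x * t).
    by apply: sin_ge0_pi; rewrite xt0/=; have := pi_gt0 R; lra.
  have ss : sin (x * t) <= sin t.
    have := pi_gt0 R => p0.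
    move: (xtt); rewrite !le_eqVlt => /orP[/eqP->|]; first by rewrite eqxx.
    by rewrite -ltr_sin ?in_itv/=; [move=> ->; rewrite orbT| lra|lra].
  have e := sin2cos2 t; rewrite expr2 in e.
  nra.
rewrite -[X in _ - X](divff W00) -mulrBl normrM normfV (gtr0_norm W0).
rewrite ler_pdivrMr// ler0_norm ?subr_le0// opprB mul1r.
rewrite wallisS0 in le2.
have K0 : (0 : R) < K.+1%:R by rewrite ltr0n.
have e : 2 * ((1 - (2 * K.+1%:R)^-1) * wallis K 0) = 2 * wallis K 0 - K.+1%:R^-1 * wallis K 0.
  by field; rewrite gt_eqF.
rewrite e in le2; rewrite /harmonic/=; move: le2; set ik := K.+1%:R^-1 => le2; lra.
Qed.

Lemma cvg_sine_product x : 0 < x < 1 ->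
  sine_product K x @[K --> \oo] --> sin (pi * x) / (pi * x).
Proof.
move=> x01; have /andP[x0 x1] := x01.
have pi0 := pi_gt0 R.
have xn : x != 0 by rewrite gt_eqF.
have pn : pi != 0 :> R by rewrite gt_eqF.
have c := cvg_harmonic_bound (fun K => wallis_ratio K x01).
have S0 : 0 < sin (pi * x).
  by apply: sin_gt0_pi; rewrite mulr_gt0//= gtr_pMr.
set S := sin (pi * x) / (pi * x).
(* An identity exact for every [K]; since the ratio tends to 1, the product must tend to [S]. *)
have e K : S = sine_product K x * (wallis K x / wallis K 0).
  have W0 := wallis0_gt0 K.
  have := wallis_sine_product K x; rewrite wallis00 wallis0// => h.
  rewrite /S; apply: (@mulIf _ (wallis K 0 * (pi / 2))).
    by rewrite mulf_neq0 ?gt_eqF// divr_gt0.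
  transitivity (wallis K 0 * (sin (pi * x) / (2 * x))).
    by rewrite /S; move: (pi : R) pn => p pn; field; rewrite xn pn.
  by rewrite -h; field; rewrite gt_eqF.
have r0 K : wallis K x / wallis K 0 != 0.
  apply/eqP => r; have := e K; rewrite r mulr0 => /eqP.
  by rewrite /S mulf_eq0 invr_eq0 mulf_eq0 !gt_eqF.
have -> : sine_product ^~ x = (fun K => S * (wallis K x / wallis K 0)^-1).
  by apply/funext => K; rewrite {1}(e K) mulfK.
rewrite -[X in _ --> X]mulr1 -[1 in X in _ --> X]invr1.
apply: cvgMr; apply: cvgV => //.
Qed.

End SineProduct.

(** * The reflection formula *)

Section Reflection.
Variable R : realType.
Implicit Types x : R.

(** The factors [k + x] and [k - x] pair up to [k ^ 2 - x ^ 2]. Since [1 - x + k = (k + 1) - x], the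
    pairing is shifted by one and leaves [x] and [K + 1 - x] unpaired. *)
Lemma lnGamma_approx_reflection K x : 0 < x < 1 ->
  lnGamma_approx K x + lnGamma_approx K (1 - x) =
  ln K.+1%:R - ln (K.+1%:R - x) - ln x - ln (sine_product K x).
Proof.
move=> /andP[x0 x1]; rewrite /lnGamma_approx /sine_product.
elim: K => [|K IH].
  by rewrite !big_nat1 big_nil !addr0 fact0 ln1 !mulr0; ring.
have K1 : (0 : R) < K.+1%:R by rewrite ltr0n.
have K2 : (0 : R) < K.+2%:R by rewrite ltr0n.
have Kf : (0 : R) < K`!%:R by rewrite ltr0n fact_gt0.
have K1ge : (1 : R) <= K.+1%:R by rewrite ler1n.
have P0 : 0 < \prod_(0 <= k < K) (1 - x ^+ 2 / k.+1%:R ^+ 2).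
  apply: prodr_gt0 => k _; rewrite subr_gt0 ltr_pdivrMr ?exprn_gt0 ?ltr0n// mul1r.
  rewrite ltr_pXn2r ?nnegrE ?ler0n ?(ltW x0)//.
  by apply: (lt_le_trans x1); rewrite ler1n.
have q0 : 1 - x ^+ 2 / K.+1%:R ^+ 2 = (K.+1%:R - x) * (x + K.+1%:R) / K.+1%:R ^+ 2.
  by field; rewrite gt_eqF.
have Kx0 : 0 < K.+1%:R - x by lra.
have xK0 : 0 < x + K.+1%:R by lra.
rewrite ![in \sum_(_ <= _ < K.+2) _]big_nat_recr//= [in \prod_(_ <= _ < K.+1) _]big_nat_recr//=.
rewrite [in ln (_ * (1 - _))]lnM ?posrE//; last first.
  by rewrite q0 divr_gt0 ?mulr_gt0 ?exprn_gt0.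
rewrite q0 ln_div ?posrE ?mulr_gt0 ?exprn_gt0// lnM ?posrE// lnXn// mulr2n.
rewrite factS natrM lnM ?posrE//.
have -> : 1 - x + K.+1%:R = K.+2%:R - x :> R by rewrite -[K.+2%:R]natr1; ring.
move: IH.
set A := \sum_(_ <= _ < _) _; set B := \sum_(_ <= _ < _) _.
set P := ln (\prod_(_ <= _ < _) _).
move: (ln K.+1%:R) (ln K.+2%:R) (ln K`!%:R) (ln (K.+1%:R - x)) (ln (x + K.+1%:R)) (ln (K.+2%:R - x)).
by move=> a b c d e f IH; lra.
Qed.

Lemma lnGamma_reflection x : 0 < x < 1 ->
  ln (Gamma x) + ln (Gamma (1 - x)) = ln pi - ln (sin (pi * x)).
Proof.
move=> x01; have /andP[x0 x1] := x01; have p0 := pi_gt0 R.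
have s0 : 0 < sin (pi * x) by apply: sin_gt0_pi; rewrite mulr_gt0//= gtr_pMr.
have c1 : lnGamma_approx K x + lnGamma_approx K (1 - x) @[K --> \oo] -->
    ln (Gamma x) + ln (Gamma (1 - x)).
  by apply: cvgD; apply: cvg_lnGamma_approx => //; lra.
have c2 : (ln K.+1%:R - ln (K.+1%:R - x)) - ln x - ln (sine_product K x) @[K --> \oo] -->
    0 - ln x - ln (sin (pi * x) / (pi * x)).
  apply: cvgB; [apply: cvgB; last exact: cvg_cst|].
    (* The constant comes from [K + 1 - x >= (1 - x) (K + 1)]. *)
    apply: (@cvg_harmonic_bound R (fun K => ln K.+1%:R - ln (K.+1%:R - x)) 0 (x / (1 - x))) => K.
    have K0 : (0 : R) < K.+1%:R by rewrite ltr0n.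
    have K1 : (1 : R) <= K.+1%:R by rewrite ler1n.
    have Kx : 0 < K.+1%:R - x by lra.
    have := @ln_bounds R (K.+1%:R - x) x Kx; rewrite subrK => /(_ K0) /andP[h1 h2].
    have h3 : 0 <= x / K.+1%:R by rewrite divr_ge0// ltW.
    rewrite subr0 ger0_norm; last exact: le_trans h3 h1.
    apply: (le_trans h2); rewrite /harmonic/= -[leRHS]mulrA ler_wpM2l ?(ltW x0)//.
    have x1' : 0 < 1 - x by lra.
    rewrite -invfM lef_pV2 ?posrE ?mulr_gt0//.
    by rewrite mulrBl mul1r lerD2l lerN2 ler_peMr// ltW.
  apply: continuous_cvg; last exact: cvg_sine_product.
  by apply: continuous_ln; rewrite divr_gt0 ?mulr_gt0.
have c3 : lnGamma_approx K x + lnGamma_approx K (1 - x) @[K --> \oo] -->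
    0 - ln x - ln (sin (pi * x) / (pi * x)).
  by apply: cvg_trans c2; apply: near_eq_cvg; near=> K; rewrite lnGamma_approx_reflection.
rewrite (cvg_unique _ c1 c3)//.
rewrite ln_div ?posrE ?mulr_gt0// lnM ?posrE//; ring.
Unshelve. all: by end_near. Qed.

End Reflection.

(** * The Fourier series of the logarithm of the sine *)

Section LogSine.
Variable R : realType.
Implicit Types t : R.

Definition cos_series K t : R := \sum_(0 <= k < K) cos (k.+1%:R * t) / k.+1%:R.

(** Telescoping of [2 sin (t / 2) sin (k t) = cos ((k - 1/2) t) - cos ((k + 1/2) t)], carried out by
    induction. *)
Lemma is_derive_cos_series K t : sin (2^-1 * t) != 0 ->
  is_derive t 1 (cos_series K)
    (- ((cos (2^-1 * t) - cos ((K%:R + 2^-1) * t)) / (2 * sin (2^-1 * t)))).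
Proof.
move=> s0; elim: K => [|K IH].
  rewrite (_ : cos_series 0 = cst 0); last first.
    by apply/funext => u; rewrite /cos_series big_nil.
  by apply: is_derive_eq; rewrite add0r subrr mul0r oppr0.
rewrite (_ : cos_series K.+1 = (fun u => cos_series K u + K.+1%:R^-1 * cos (K.+1%:R * u))); last first.
  by apply/funext => u; rewrite /cos_series big_nat_recr//= [in RHS]mulrC.
have dc := is_derive_cosM K.+1%:R t.
have K0 : K.+1%:R != 0 :> R by rewrite pnatr_eq0.
apply: is_derive_eq; rewrite /GRing.scale/=.
have -> : K.+1%:R^-1 * (- K.+1%:R * sin (K.+1%:R * t)) = - sin (K.+1%:R * t).
  by field.
have -> : (K%:R + 2^-1) * t = K.+1%:R * t - 2^-1 * t by rewrite -natr1; field.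
have -> : (K.+1%:R + 2^-1) * t = K.+1%:R * t + 2^-1 * t by ring.
rewrite cosB cosD; field; exact: s0.
Qed.

(* The last term cancels the oscillating part of the derivative of the partial
   sum, so that what remains is O(1/K) uniformly on [[t, pi]]. *)
Definition cos_series_corr K t : R :=
  cos_series K t + ln (sin (2^-1 * t))
  - (2 * (K%:R + 2^-1))^-1 * (sin ((K%:R + 2^-1) * t) / sin (2^-1 * t)).

Lemma is_derive_cos_series_corr K t : 0 < sin (2^-1 * t) ->
  is_derive t 1 (cos_series_corr K)
   ((2 * (K%:R + 2^-1))^-1 * (sin ((K%:R + 2^-1) * t) * cos (2^-1 * t) / (2 * sin (2^-1 * t) ^+ 2))).
Proof.
move=> s0; have sn : sin (2^-1 * t) != 0 by rewrite gt_eqF.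
have d1 := is_derive_cos_series K sn.
have ds := is_derive_sinM 2^-1 t.
have dS := is_derive_sinM (K%:R + 2^-1) t.
have dl := is_derive1_comp (is_derive1_ln s0) ds.
have dV : is_derive t 1 (fun u => (sin (2^-1 * u))^-1)
    (- (sin (2^-1 * t)) ^- 2 * (2^-1 * cos (2^-1 * t))).
  apply: DeriveDef; first by apply: derivableV.
  by rewrite deriveV// derive_val.
have K0 : K%:R + 2^-1 != 0 :> R by rewrite gt_eqF// ltr_wpDl ?ler0n.
rewrite /cos_series_corr.
apply: is_derive_eq; rewrite /GRing.scale/=.
by move: (K%:R + 2^-1) K0 => a a0; field; rewrite sn a0.
Qed.

Let half_ge1 K : (0 : R) < K%:R + 2^-1.
Proof. by have := ler0n R K; lra. Qed.

Let harmonic_bound K : (2 * (K%:R + 2^-1))^-1 <= harmonic K :> R.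
Proof.
rewrite /harmonic/= lef_pV2 ?posrE ?mulr_gt0 ?ltr0n// -natr1.
by have := ler0n R K; lra.
Qed.

Let pihalfE : 2^-1 * pi = pi / 2 :> R.
Proof. by rewrite mulrC. Qed.

(** Mean value theorem on [[t, pi]], where [sin (u / 2)] is smallest at [u = t]. *)
Lemma cos_series_corr_pi K t : 0 < t <= pi ->
  `|cos_series_corr K pi - cos_series_corr K t| <=
  (pi / (2 * sin (2^-1 * t) ^+ 2)) * harmonic K.
Proof.
move=> /andP[t0 tpi]; have p0 := pi_gt0 R.
have sle c : t <= c -> c <= pi -> sin (2^-1 * t) <= sin (2^-1 * c).
  rewrite le_eqVlt => /orP[/eqP->//|tc] cpi.
  by apply: ltW; rewrite ltr_sin ?in_itv/=; lra.
have st0 : 0 < sin (2^-1 * t) by apply: sin_gt0_pi; lra.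
have sc0 c : t <= c -> c <= pi -> 0 < sin (2^-1 * c).
  by move=> tc cpi; exact: lt_le_trans st0 (sle _ tc cpi).
have [||/= c] := MVT_segment tpi (f := cos_series_corr K) (df := fun t =>
   ((2 * (K%:R + 2^-1))^-1 * (sin ((K%:R + 2^-1) * t) * cos (2^-1 * t) / (2 * sin (2^-1 * t) ^+ 2)))).
- move=> u; rewrite in_itv/= => /andP[tu upi].
  by apply: is_derive_cos_series_corr; apply: sc0; exact: ltW.
- apply: derivable_within_continuous => u; rewrite in_itv/= => /andP[tu upi].
  by have [] := is_derive_cos_series_corr K (sc0 _ tu upi).
rewrite in_itv/= => /andP[tc cpi] ->.
have s0 := sc0 _ tc cpi; have le_s := sle _ tc cpi.
set A := (2 * (K%:R + 2^-1))^-1.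
have A0 : 0 < A by rewrite invr_gt0 mulr_gt0.
rewrite !normrM (gtr0_norm A0).
have n1 : `|(2 * sin (2^-1 * c) ^+ 2)^-1| <= (2 * sin (2^-1 * t) ^+ 2)^-1.
  rewrite ger0_norm; last by rewrite invr_ge0 mulr_ge0// sqr_ge0.
  rewrite lef_pV2 ?posrE ?mulr_gt0 ?exprn_gt0// ler_wpM2l//.
  by rewrite ler_pXn2r ?nnegrE ?(ltW st0) ?(ltW s0).
have n2 : `|pi - t| <= pi by rewrite ger0_norm; lra.
have n3 : `|sin ((K%:R + 2^-1) * c)| * `|cos (2^-1 * c)| * `|(2 * sin (2^-1 * c) ^+ 2)^-1|
    <= (2 * sin (2^-1 * t) ^+ 2)^-1.
  apply: (le_trans _ n1); rewrite ler_piMl ?normr_ge0// mulr_ile1 ?normr_ge0//.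
    exact: sin_max.
  exact: cos_max.
have -> : pi / (2 * sin (2^-1 * t) ^+ 2) * harmonic K =
    harmonic K * (2 * sin (2^-1 * t) ^+ 2)^-1 * pi by rewrite mulrC mulrA mulrAC.
apply: ler_pM => //; first by rewrite !mulr_ge0 ?normr_ge0// ltW.
by apply: ler_pM; rewrite ?mulr_ge0 ?normr_ge0 ?(ltW A0)//; exact: harmonic_bound.
Qed.

Lemma cvg_cos_series_subpi t : 0 < t <= pi ->
  cos_series K t - cos_series K pi @[K --> \oo] --> - ln (sin (2^-1 * t)).
Proof.
move=> tpi; have p0 := pi_gt0 R; have /andP[t0 tp] := tpi.
have st0 : 0 < sin (2^-1 * t) by apply: sin_gt0_pi; lra.
pose C := pi / (2 * sin (2^-1 * t) ^+ 2).
(* The three parts of the constant bound the variation of [cos_series_corr] and the oscillating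
   correction at [pi] and at [t]. *)
apply: (@cvg_harmonic_bound _ _ _ (C + (1 + (sin (2^-1 * t))^-1))) => K.
rewrite opprK.
have b := cos_series_corr_pi K tpi; rewrite -/C in b.
pose A : R := (2 * (K%:R + 2^-1))^-1.
have A0 : 0 < A by rewrite invr_gt0 mulr_gt0.
have e : cos_series K t - cos_series K pi + ln (sin (2^-1 * t)) =
  - (cos_series_corr K pi - cos_series_corr K t)
  - A * sin ((K%:R + 2^-1) * pi) + A * (sin ((K%:R + 2^-1) * t) / sin (2^-1 * t)).
  rewrite /cos_series_corr -/A pihalfE sin_pihalf ln1 divr1; ring.
have -> : (C + (1 + (sin (2^-1 * t))^-1)) * harmonic K =
  (C * harmonic K + harmonic K) + (sin (2^-1 * t))^-1 * harmonic K by ring.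
rewrite e; apply: (le_trans (ler_normD _ _)); apply: lerD.
  apply: (le_trans (ler_normB _ _)); rewrite normrN; apply: lerD => //.
  rewrite normrM (gtr0_norm A0); apply: le_trans (harmonic_bound K).
  by rewrite ler_piMr ?sin_max ?ltW.
rewrite !normrM (gtr0_norm A0) normfV (gtr0_norm st0) mulrA mulrC.
rewrite ler_wpM2l ?invr_ge0 ?(ltW st0)//; apply: le_trans (harmonic_bound K).
by rewrite ler_piMr ?sin_max ?ltW.
Qed.

Lemma cos_nat_pi k : cos (k%:R * pi) = (-1) ^+ k :> R.
Proof.
elim: k => [|k IH]; first by rewrite mul0r cos0.
by rewrite -natr1 mulrDl mul1r cosDpi IH exprS mulN1r.
Qed.

(** The alternating harmonic terms are added in pairs [- 1 / (2 M + 1) + 1 / (2 M + 2)], which match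
    the increments on the right. *)
Lemma cos_series_pi M :
  cos_series M.*2 pi = series (@harmonic R) M - series (@harmonic R) M.*2.
Proof.
have HS m : series (@harmonic R) m.+1 = series (@harmonic R) m + m.+1%:R^-1.
  by rewrite /series/= big_nat_recr.
have cS m : cos_series m.+1 pi = cos_series m pi + (-1) ^+ m.+1 / m.+1%:R.
  by rewrite /cos_series big_nat_recr//= cos_nat_pi.
elim: M => [|M IH]; first by rewrite /cos_series /series/= !big_nil subrr.
rewrite doubleS !cS !HS IH !exprS -muln2 exprM sqrr_sign.
have -> : (M * 2).+2%:R = 2 * M.+1%:R :> R by rewrite -addn2 natrD natrM -[M.+1%:R]natr1; ring.
have h : M.+1%:R != 0 :> R by rewrite pnatr_eq0.
have h2 : (M * 2).+1%:R != 0 :> R by rewrite pnatr_eq0.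
by move: M.+1%:R (M * 2).+1%:R h h2 => p q h h2; field; rewrite h h2.
Qed.

Lemma cvg_increasing_index (phi : nat -> nat) : (forall m, (m <= phi m)%N) ->
  phi @ \oo --> \oo.
Proof.
move=> h A [N _ NA]; exists N => //= m Nm.
by apply: NA => /=; apply: leq_trans (h m).
Qed.

Lemma cvg_cos_series_pi :
  cos_series M.*2 pi @[M --> \oo] --> - ln (2 : R).
Proof.
pose h m : R := series (@harmonic R) m - ln (m%:R : R).
have c2 : h M.*2 @[M --> \oo] --> euler_gamma R.
  apply: (cvg_comp (fun M => M.*2) h); last exact: cvg_euler_gamma.
  by apply: cvg_increasing_index => m; rewrite -addnn leq_addr.
have c : h M - h M.*2 - ln 2 @[M --> \oo] --> euler_gamma R - euler_gamma R - ln 2.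
  by apply: cvgB; [apply: cvgB => //; exact: cvg_euler_gamma|exact: cvg_cst].
rewrite subrr sub0r in c; apply: cvg_trans c; apply: near_eq_cvg; near=> M.
(* Splitting [ln (2 M)] as [ln 2 + ln M] requires [M > 0]. *)
have M0 : (0 < M)%N by near: M; exists 1%N.
rewrite cos_series_pi /h -mul2n natrM lnM ?posrE ?ltr0n//; ring.
Unshelve. all: by end_near. Qed.

Lemma pi2_muln k : (pi *+ 2) *+ k = 2 * pi * k%:R :> R.
Proof. by rewrite -[LHS]mulr_natr -[pi *+ 2]mulr_natr [pi * _]mulrC. Qed.

Lemma cosD2pin (a : R) k : cos (a + 2 * pi * k%:R) = cos a.
Proof. by rewrite -pi2_muln (periodicn (@cosD2pi R)). Qed.

Lemma sinD2pin (a : R) k : sin (a + 2 * pi * k%:R) = sin a.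
Proof. by rewrite -pi2_muln (periodicn (@sinD2pi R)). Qed.

(** Partial sums of length [2 n M] suffice: the length is even, so that the value at [pi] is
    available, and a multiple of [n], to match the complete residue blocks of [sum_inv_residues]. *)
Lemma cvg_cos_series t n : (0 < n)%N -> 0 < t < 2 * pi ->
  cos_series (n * M).*2 t @[M --> \oo] --> - ln (2 * sin (2^-1 * t)).
Proof.
move=> n0; have p0 := pi_gt0 R.
wlog tpi : t / t <= pi => [H|] tt.
  have [|tpi] := leP t pi; first by move/H; apply.
  (* Each [cos (k t)] is invariant under [t -> 2 pi - t], which brings [t] below [pi]. *)
  have := H (2 * pi - t) ltac:(lra) ltac:(lra).
  have -> : 2^-1 * (2 * pi - t) = - (2^-1 * t) + pi by move: (pi : R) => p; field.
  rewrite sinDpi sinN opprK => {}H; apply: cvg_trans H; apply: near_eq_cvg; near=> M.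
  apply: eq_bigr => k _; congr (_ / _).
  have -> : k.+1%:R * (2 * pi - t) = - (k.+1%:R * t) + 2 * pi * k.+1%:R :> R.
    by move: (pi : R) (k.+1%:R : R) => p q; ring.
  by rewrite cosD2pin cosN.
have /andP[t0 _] := tt.
have st0 : 0 < sin (2^-1 * t) by apply: sin_gt0_pi; lra.
rewrite lnM ?posrE// opprD addrC.
have c1 : cos_series (n * M).*2 t - cos_series (n * M).*2 pi @[M --> \oo] -->
    - ln (sin (2^-1 * t)).
  apply: (cvg_comp (fun M => (n * M).*2) (fun K => cos_series K t - cos_series K pi)).
    apply: cvg_increasing_index => m; rewrite -addnn.
    by rewrite (leq_trans (leq_pmull m n0))// leq_addr.
  by apply: cvg_cos_series_subpi; rewrite t0.
have c2 : cos_series (n * M).*2 pi @[M --> \oo] --> - ln (2 : R).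
  apply: (cvg_comp (fun M => n * M)%N (fun K => cos_series K.*2 pi)).
    by apply: cvg_increasing_index => m; rewrite leq_pmull.
  exact: cvg_cos_series_pi.
have -> : (fun M => cos_series (n * M).*2 t) = (fun M =>
    cos_series (n * M).*2 t - cos_series (n * M).*2 pi + cos_series (n * M).*2 pi).
  by apply/funext => M; rewrite subrK.
exact: cvgD.
Unshelve. all: by end_near. Qed.

End LogSine.

(** * Gauss's digamma formula *)

Section FiniteFourier.
Variable R : realType.

(** The Dirichlet kernel: multiplied by [2 sin y], the terms telescope. *)
Lemma sum_cos_multiples (y : R) n : sin y != 0 ->
  \sum_(0 <= k < n) cos (2 * k%:R * y) =
  (sin ((2 * n%:R - 1) * y) + sin y) / (2 * sin y).
Proof.
move=> s0; elim: n => [|n IH].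
  by rewrite big_nil mulr0 sub0r mulN1r sinN addNr mul0r.
rewrite big_nat_recr//= IH -[n.+1%:R]natr1.
have -> : (2 * (n%:R + 1) - 1) * y = 2 * n%:R * y + y by ring.
have -> : (2 * n%:R - 1) * y = 2 * n%:R * y - y by ring.
by rewrite sinB sinD; field.
Qed.

(** With [y = pi m / n], the angle [(2 n - 1) y] is [- y] up to a multiple of [2 pi], so the closed
    form vanishes. The range of [m] goes up to [2 n] because sums of two frequencies occur in
    [sum_cos_roots_orthogonal]. *)
Lemma sum_cos_roots n m : (0 < m)%N -> (m < n.*2)%N -> m != n ->
  \sum_(0 <= k < n) cos (2 * pi * k%:R * m%:R / n%:R : R) = 0.
Proof.
move=> m0 mn2 mn; have p0 := pi_gt0 R.
have n0 : (0 < n)%N by case: n mn2 mn.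
have nR : (0 : R) < n%:R by rewrite ltr0n.
have mR : (0 : R) < m%:R by rewrite ltr0n.
have nn : n%:R != 0 :> R by rewrite gt_eqF.
pose y : R := pi * m%:R / n%:R.
have y0 : 0 < y by rewrite divr_gt0// mulr_gt0.
have sy : sin y != 0.
  have [lmn|lnm|/eqP] := ltngtP m n; last by rewrite (negbTE mn).
    rewrite gt_eqF// sin_gt0_pi// y0/= ltr_pdivrMr// ltr_pM2l//.
    by rewrite ltr_nat.
  rewrite -[y](subrK pi) sinDpi oppr_eq0 gt_eqF// sin_gt0_pi// subr_gt0.
  rewrite ltr_pdivlMr// ltr_pM2l// ltr_nat lnm/= ltrBlDr -mulr2n.
  by rewrite ltr_pdivrMr// -[pi *+ 2]mulr_natr -mulrA ltr_pM2l// -natrM mul2n ltr_nat.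
transitivity (\sum_(0 <= k < n) cos (2 * k%:R * y)).
  apply: eq_bigr => k _; congr cos; rewrite /y.
  by move: (pi : R) => p; field.
rewrite sum_cos_multiples//.
have -> : (2 * n%:R - 1) * y = - y + 2 * pi * m%:R.
  by rewrite /y; move: (pi : R) => p; field.
by rewrite sinD2pin sinN addNr mul0r.
Qed.

(** Product to sum: the frequencies [l - (r + 1)] and [l + (r + 1)] contribute only when divisible
    by [n], that is for [r + 1 = l] and for [r + 1 = n - l]. Both happen at once when [n = 2 l],
    hence a sum of indicators. *)
Lemma sum_cos_roots_orthogonal n l r : (0 < l < n)%N -> (r < n)%N ->
  \sum_(0 <= k < n) 2 * cos (2 * pi * k%:R * l%:R / n%:R : R)
     * cos (r.+1%:R * (2 * pi * k%:R / n%:R)) =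
  n%:R * ((r == l.-1)%:R + (r == (n - l).-1)%:R).
Proof.
move=> /andP[l0 ln] rn.
have n0 : (0 < n)%N by apply: leq_trans rn.
have nn : n%:R != 0 :> R by rewrite pnatr_eq0 -lt0n.
have p1 : \sum_(0 <= k < n) cos (2 * pi * k%:R * (l%:R - r.+1%:R) / n%:R : R) =
    n%:R * (r == l.-1)%:R.
  have [e|ne] := eqVneq r l.-1.
    rewrite e prednK// subrr; under eq_bigr do rewrite mulr0 mul0r cos0.
    by rewrite big_const_nat iter_addr_0 subn0 mulr1.
  rewrite mulr0; have [lr|rl] := ltnP r.+1 l.
    under eq_bigr do rewrite -natrB 1?ltnW//.
    apply: sum_cos_roots; first by rewrite subn_gt0.
      by rewrite -addnn (leq_trans _ (leq_addr n n))// (leq_ltn_trans (leq_subr _ _)).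
    by rewrite ltn_eqF// (leq_ltn_trans (leq_subr _ _)).
  have lr : (l < r.+1)%N.
    by rewrite ltn_neqAle rl andbT; apply: contra ne => /eqP ->.
  have e k : cos (2 * pi * k%:R * (l%:R - r.+1%:R) / n%:R : R) =
     cos (2 * pi * k%:R * (r.+1 - l)%:R / n%:R).
    by rewrite natrB 1?ltnW// -cosN; congr cos; rewrite -mulNr -mulrN opprB.
  under eq_bigr do rewrite e.
  have rln : (r.+1 - l < n)%N by rewrite (ltn_subLR _ (ltnW lr)) -[r.+2]add1n leq_add.
  apply: sum_cos_roots; first by rewrite subn_gt0.
    by rewrite -addnn (leq_trans rln)// leq_addr.
  by rewrite ltn_eqF.
have p2 : \sum_(0 <= k < n) cos (2 * pi * k%:R * (l + r.+1)%:R / n%:R : R) =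
    n%:R * (r == (n - l).-1)%:R.
  have [e|ne] := eqVneq r (n - l).-1.
    rewrite e prednK ?subn_gt0// subnKC 1?ltnW// mulr1.
    under eq_bigr => k _.
      rewrite mulfK//.
      rewrite -[2 * pi * _]add0r cosD2pin cos0.
      over.
    by rewrite big_const_nat iter_addr_0 subn0.
  rewrite mulr0; apply: sum_cos_roots; first by rewrite addnS.
    by rewrite -addnn -addSn leq_add.
  apply: contra ne => /eqP e; apply/eqP.
  by rewrite -e addKn.
rewrite [RHS]mulrDr -p1 -p2 -big_split/=; apply: eq_bigr => k _.
set a := 2 * pi * k%:R * l%:R / n%:R; set b := r.+1%:R * _.
have -> : 2 * pi * k%:R * (l%:R - r.+1%:R) / n%:R = a - b :> R.
  by rewrite /a /b; ring.
have -> : 2 * pi * k%:R * (l + r.+1)%:R / n%:R = a + b :> R.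
  by rewrite /a /b natrD; ring.
by rewrite cosB cosD; ring.
Qed.

(** The cosines of a block of frequencies [n N + r + 1] do not depend on [N], so orthogonality
    selects the frequencies congruent to [l] or [- l] modulo [n], and
    [n / (n N + l) = 1 / (l / n + N)]. *)
Lemma sum_inv_residues n l N : (0 < l < n)%N ->
  \sum_(0 <= k < N) ((l%:R / n%:R + k%:R)^-1 + (1 - l%:R / n%:R + k%:R)^-1) =
  \sum_(0 <= nu < n) 2 * cos (2 * pi * nu%:R * l%:R / n%:R : R)
     * cos_series (n * N) (2 * pi * nu%:R / n%:R).
Proof.
move=> ln; have /andP[l0 ltn] := ln.
have n0 : (0 < n)%N by apply: ltn_trans ltn.
have nn : n%:R != 0 :> R by rewrite pnatr_eq0 -lt0n.
have nlt : (n - l < n)%N by rewrite ltn_subrL l0.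
have nl0 : (0 < n - l)%N by rewrite subn_gt0.
elim: N => [|N IH].
  rewrite big_nil big1// => k _.
  by rewrite muln0 /cos_series big_nil mulr0.
have stepc nu : cos_series (n * N.+1) (2 * pi * nu%:R / n%:R : R) =
    cos_series (n * N) (2 * pi * nu%:R / n%:R) +
    \sum_(0 <= r < n) cos (r.+1%:R * (2 * pi * nu%:R / n%:R)) / (n * N + r.+1)%:R.
  rewrite /cos_series mulnS [(n + n * N)%N]addnC (big_cat_nat (leq0n (n * N)) (leq_addr n _))/=.
  congr (_ + _); rewrite -{1}[(n * N)%N]add0n big_addn addKn.
  apply: eq_bigr => r _.
  have -> : (r + n * N).+1 = (n * N + r.+1)%N by rewrite addnS addnC.
  congr (_ / _); rewrite natrD natrM.
  have -> : (n%:R * N%:R + r.+1%:R) * (2 * pi * nu%:R / n%:R) =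
     r.+1%:R * (2 * pi * nu%:R / n%:R) + 2 * pi * (N * nu)%:R :> R.
    by rewrite natrM; move: (pi : R) (r.+1%:R : R) => p q; field.
  by rewrite cosD2pin.
rewrite big_nat_recr//= IH.
under [RHS]eq_bigr do rewrite stepc mulrDr.
rewrite big_split/=; congr (_ + _).
under eq_bigr do rewrite mulr_sumr.
rewrite exchange_big/=.
transitivity (\sum_(0 <= r < n) ((if r == l.-1 then n%:R / (n * N + r.+1)%:R else 0) +
    (if r == (n - l).-1 then n%:R / (n * N + r.+1)%:R else 0)) : R).
  rewrite big_split/= -!big_mkcond/= !big_nat1_eq/=.
  rewrite !ifT; last 2 first.
  - by rewrite prednK// ltnW.
  - by rewrite prednK// ltnW.
  rewrite !prednK//.
  have N0 := ler0n R N; have lR : (0 : R) < l%:R by rewrite ltr0n.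
  have nR : (0 : R) < n%:R by rewrite ltr0n.
  have lnR : (l%:R : R) < n%:R by rewrite ltr_nat.
  have nN : 0 <= n%:R * N%:R :> R by rewrite mulr_ge0.
  rewrite !natrD !natrM natrB 1?ltnW//.
  congr (_ + _); field; rewrite nn/= ?andbT; rewrite gt_eqF//; nra.
apply: eq_big_nat => r /andP[_ rn].
transitivity ((\sum_(0 <= k < n) 2 * cos (2 * pi * k%:R * l%:R / n%:R : R)
     * cos (r.+1%:R * (2 * pi * k%:R / n%:R))) / (n * N + r.+1)%:R).
  rewrite sum_cos_roots_orthogonal//.
  case: (r == l.-1); case: (r == (n - l).-1); rewrite /=; ring.
by rewrite mulr_suml; apply: eq_bigr => k _; rewrite -[LHS]mulrA.
Qed.

End FiniteFourier.

Section GaussFormula.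
Variable R : realType.

Lemma cvg_sum_nat (f : nat -> nat -> R) (l : nat -> R) m n :
  (forall k, (m <= k < n)%N -> f k M @[M --> \oo] --> l k) ->
  \sum_(m <= k < n) f k M @[M --> \oo] --> \sum_(m <= k < n) l k.
Proof.
have [nm|mn] := leqP n m.
  move=> _; rewrite big_geq//; under eq_fun do rewrite big_geq//.
  exact: cvg_cst.
elim: n mn => // n IH mn H; rewrite ltnS in mn.
rewrite big_nat_recr//=; under eq_fun do rewrite big_nat_recr//=.
apply: cvgD; last by apply: H; rewrite mn/=.
have [nm|mn'] := leqP n m.
  rewrite big_geq//; under eq_fun do rewrite big_geq//.
  exact: cvg_cst.
by apply: IH => // k /andP[mk kn]; apply: H; rewrite mk ltnW.
Qed.

Lemma frac_gt0_lt1 n l : (0 < l < n)%N -> 0 < (l%:R / n%:R : R) < 1.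
Proof.
move=> /andP[l0 ln]; have n0 : (0 : R) < n%:R by rewrite ltr0n (ltn_trans l0).
apply/andP; split; first by apply: divr_gt0 => //; rewrite ltr0n.
by rewrite ltr_pdivrMr// mul1r ltr_nat.
Qed.

Lemma sum_cos_roots1 n l : (0 < l < n)%N ->
  \sum_(1 <= k < n) cos (2 * pi * k%:R * l%:R / n%:R : R) = -1.
Proof.
move=> /andP[l0 ln].
have := @sum_cos_roots R n l l0; rewrite -addnn (leq_trans ln) ?leq_addr//.
rewrite ltn_eqF// => /(_ isT isT).
rewrite big_ltn ?(ltn_trans l0 ln)// mulr0 !mul0r cos0 => /eqP.
by rewrite addrC addr_eq0 => /eqP.
Qed.

(** In [sum_inv_residues] the term [nu = 0] is a harmonic sum, which together with the logarithms of
    the approximations yields [euler_gamma]; every other term converges by the log-sine series. *)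
Lemma digamma_symmetric n l : (0 < l < n)%N ->
  digamma (l%:R / n%:R : R) + digamma (1 - l%:R / n%:R : R) =
  - 2 * euler_gamma R - 2 * ln (2 * n%:R) +
  2 * \sum_(1 <= nu < n) cos (2 * pi * nu%:R * l%:R / n%:R : R) * ln (sin (pi * nu%:R / n%:R)).
Proof.
move=> l0n; have /andP[l0 ltn] := l0n.
have n0 : (0 < n)%N by apply: ltn_trans ltn.
have nR : (0 : R) < n%:R by rewrite ltr0n.
have nn : n%:R != 0 :> R by rewrite gt_eqF.
have p0 := pi_gt0 R.
have x01 := frac_gt0_lt1 l0n.
pose x : R := l%:R / n%:R.
(* An even number of blocks: [cos_series] is evaluated at [pi] in closed form
   only for an even number of terms. *)
pose phi M := M.+1.*2.-1.
have phiE M : (phi M).+1 = M.+1.*2 by [].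
have cphi : phi @ \oo --> \oo.
  apply: cvg_increasing_index => m.
  by rewrite /phi doubleS/= -addnn -addSn leq_addl.
have c1 : digamma_approx (phi M) x + digamma_approx (phi M) (1 - x) @[M --> \oo] -->
    digamma x + digamma (1 - x).
  have x01' : 0 < 1 - x < 1 by rewrite /x; lra.
  apply: cvgD; first exact: (cvg_comp _ _ cphi (cvg_digamma_approx x01)).
  exact: (cvg_comp _ _ cphi (cvg_digamma_approx x01')).
pose h m : R := series (@harmonic R) m - ln (m%:R : R).
have c2 : - 2 * h (n * M.+1).*2 - 2 * ln n%:R
   - (\sum_(1 <= nu < n) 2 * cos (2 * pi * nu%:R * l%:R / n%:R : R)
     * cos_series (n * M.+1).*2 (2 * pi * nu%:R / n%:R)) @[M --> \oo] -->
  - 2 * euler_gamma R - 2 * ln n%:R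
  - (\sum_(1 <= nu < n) 2 * cos (2 * pi * nu%:R * l%:R / n%:R : R)
     * - ln (2 * sin (2^-1 * (2 * pi * nu%:R / n%:R)))).
  apply: cvgB; [apply: cvgB; last exact: cvg_cst|].
    apply: cvgMr; apply: (cvg_comp (fun M => (n * M.+1).*2) h); last exact: cvg_euler_gamma.
    apply: cvg_increasing_index => m; rewrite -addnn.
    by apply: leq_trans (leq_addr _ _); rewrite (leq_trans (leqnSn m))// leq_pmull.
  apply: cvg_sum_nat => k /andP[k0 kn]; apply: cvgMr.
  apply: (cvg_comp S (fun M => cos_series (n * M).*2 (2 * pi * k%:R / n%:R))).
    exact: cvg_increasing_index.
  apply: cvg_cos_series => //.
  have /andP[f0 f1] := @frac_gt0_lt1 n k ltac:(by rewrite k0).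
  have pp : 0 < 2 * pi :> R by rewrite mulr_gt0.
  by rewrite -[2 * pi * _ / _]mulrA (mulr_gt0 pp f0)/= gtr_pMr.
have e M : digamma_approx (phi M) x + digamma_approx (phi M) (1 - x) =
  - 2 * h (n * M.+1).*2 - 2 * ln n%:R
   - (\sum_(1 <= nu < n) 2 * cos (2 * pi * nu%:R * l%:R / n%:R : R)
     * cos_series (n * M.+1).*2 (2 * pi * nu%:R / n%:R)).
  rewrite /digamma_approx phiE addrACA -opprD -big_split/= sum_inv_residues//.
  rewrite (big_ltn n0) mulr0 !mul0r cos0 mulr1 -doubleMr opprD addrA; congr (_ - _).
  rewrite /cos_series /h /series/=.
  under eq_bigr do rewrite mulr0 cos0 div1r.
  have -> : (n * M.+1).*2%:R = n%:R * M.+1.*2%:R :> R by rewrite -natrM doubleMr.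
  rewrite lnM ?posrE ?ltr0n ?double_gt0//; ring.
rewrite (funext e) in c1.
rewrite -/x (cvg_unique _ c1 c2)//.
rewrite lnM ?posrE//.
(* The factor 2 inside the logarithms of [2 sin] is split off; since the cosines sum to -1 it
   contributes [- 2 ln 2]. *)
transitivity (- 2 * euler_gamma R - 2 * ln n%:R +
  (2 * ln 2 * (\sum_(1 <= k < n) cos (2 * pi * k%:R * l%:R / n%:R : R)) +
  2 * \sum_(1 <= nu < n) cos (2 * pi * nu%:R * l%:R / n%:R : R) * ln (sin (pi * nu%:R / n%:R)))); last first.
  by rewrite sum_cos_roots1//; ring.
congr (_ + _); rewrite -sumrN !mulr_sumr -big_split/=.
apply: eq_big_nat => k /andP[k0 kn].
have -> : 2^-1 * (2 * pi * k%:R / n%:R) = pi * k%:R / n%:R :> R.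
  by move: (pi : R) => p; field.
rewrite lnM ?posrE//; first by ring.
have /andP[f0 f1] := @frac_gt0_lt1 n k ltac:(by rewrite k0).
by apply: sin_gt0_pi; rewrite -mulrA mulr_gt0//= gtr_pMr.
Qed.

End GaussFormula.

(** * Averaging over the symmetry and comparison of both sides *)

Theorem mainTheorem10 (R : realType) (n : nat) (hn : (2 <= n)%N) :
  \sum_(1 <= nu < n)
      digamma (nu%:R / n%:R : R) * csc (pi * nu%:R / n%:R : R) =
  - (euler_gamma R + ln (2 * pi * n%:R)) * csc_sum R n
  - 2 * \sum_(1 <= nu < n)
          cos_csc_sum R n nu * ln (Gamma (nu%:R / n%:R : R)).
Proof.
have p0 := pi_gt0 R.
have n0 : (0 < n)%N by apply: ltnW.
have nR : (0 : R) < n%:R by rewrite ltr0n.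
have nn : n%:R != 0 :> R by rewrite gt_eqF.
have compl k : (1 <= k < n)%N -> (n - k)%:R / n%:R = 1 - k%:R / n%:R :> R.
  by move=> /andP[_ kn]; rewrite natrB 1?ltnW// mulrBl divff.
have sym (F : nat -> R) : \sum_(1 <= k < n) F k = \sum_(1 <= k < n) F (n - k)%N.
  by rewrite big_nat_rev/= add1n; apply: eq_bigr => k _; rewrite subSS.
have avg (F : nat -> R) :
    2 * \sum_(1 <= k < n) F k = \sum_(1 <= k < n) (F k + F (n - k)%N).
  by rewrite big_split/= -sym; ring.
have csc_compl k : (1 <= k < n)%N ->
    csc (pi * (n - k)%:R / n%:R : R) = csc (pi * k%:R / n%:R).
  move=> kn; rewrite /csc -!mulrA compl// mulrBr mulr1 addrC sinDpi sinN opprK.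
  by rewrite mulrA.
have cos_compl k l : (1 <= k < n)%N ->
    cos (2 * pi * (n - k)%:R * l%:R / n%:R : R) = cos (2 * pi * k%:R * l%:R / n%:R).
  move=> /andP[_ kn].
  rewrite natrB 1?ltnW//.
  have -> : 2 * pi * (n%:R - k%:R) * l%:R / n%:R =
      - (2 * pi * k%:R * l%:R / n%:R) + 2 * pi * l%:R :> R.
    by move: (pi : R) => p; field.
  by rewrite cosD2pin cosN.
pose LS k : R := ln (sin (pi * k%:R / n%:R)).
have lhs : 2 * (\sum_(1 <= nu < n) digamma (nu%:R / n%:R : R) * csc (pi * nu%:R / n%:R : R)) =
  \sum_(1 <= l < n) (- 2 * euler_gamma R - 2 * ln (2 * n%:R) +
    2 * \sum_(1 <= nu < n) cos (2 * pi * nu%:R * l%:R / n%:R : R) * LS nu)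
    * csc (pi * l%:R / n%:R).
  rewrite avg; apply: eq_big_nat => k kn.
  by rewrite csc_compl// compl// -mulrDl digamma_symmetric.
have rhs : 2 * (\sum_(1 <= nu < n) cos_csc_sum R n nu * ln (Gamma (nu%:R / n%:R : R))) =
  \sum_(1 <= nu < n) cos_csc_sum R n nu * (ln pi - LS nu).
  rewrite avg; apply: eq_big_nat => k kn.
  have -> : cos_csc_sum R n (n - k) = cos_csc_sum R n k.
    by apply: eq_bigr => l _; rewrite cos_compl.
  by rewrite compl// -mulrDr lnGamma_reflection ?mulrA// frac_gt0_lt1.
have csum : \sum_(1 <= nu < n) cos_csc_sum R n nu = - csc_sum R n.
  rewrite /cos_csc_sum exchange_big/= /csc_sum -sumrN.
  apply: eq_big_nat => l l0n.
  by rewrite -mulr_suml sum_cos_roots1// mulN1r.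
(* Both sides reduce to this double sum and multiples of [csc_sum]; the [ln pi] from reflection then
   accounts for the passage from [ln (2 n)] to [ln (2 pi n)]. *)
pose T := \sum_(1 <= nu < n) cos_csc_sum R n nu * LS nu.
have rhs' : 2 * (\sum_(1 <= nu < n) cos_csc_sum R n nu * ln (Gamma (nu%:R / n%:R : R))) =
  - ln pi * csc_sum R n - T.
  rewrite rhs /T; under eq_bigr do rewrite mulrBr.
  rewrite sumrB -mulr_suml csum; ring.
have lhs' : 2 * (\sum_(1 <= nu < n) digamma (nu%:R / n%:R : R) * csc (pi * nu%:R / n%:R : R)) =
  2 * (- (euler_gamma R + ln (2 * n%:R)) * csc_sum R n + T).
  rewrite lhs; under eq_bigr do rewrite mulrDl.
  rewrite big_split/= -mulr_sumr -/(csc_sum R n) [RHS]mulrDr; congr (_ + _); first by ring.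
  rewrite /T /cos_csc_sum mulr_sumr.
  under [RHS]eq_bigr do rewrite mulr_suml mulr_sumr.
  rewrite exchange_big/=; apply: eq_bigr => l _.
  rewrite mulr_sumr mulr_suml; apply: eq_bigr => k _; ring.
apply: (@mulfI _ (2 : R)); first by rewrite pnatr_eq0.
rewrite lhs' rhs'.
have -> : ln (2 * pi * n%:R) = ln (2 * n%:R) + ln pi :> R.
  by rewrite -lnM ?posrE ?mulr_gt0//; congr ln; rewrite mulrAC.
ring.
Qed.
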